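(* Let $\mathbf k$ be a field of characteristic $c$ and let $n$ and $N$ be positive integers. Then $\operatorname{pd}_{R_{\mathbf k,n}} Q_{\mathbf k,n,N}$ is finite if and only if at least one of the following holds: (1) $n$ divides $N$; or (2) $c=2$ and $n\le N$; or (3) $c=p$ is an odd prime and there exist an odd integer $J$ and a power $q=p^e$ of $p$ with $e\ge 1$ such that $\left|Jq-\frac Nn\right|<\{\frac q3\}$. In particular, if $c=0$, then $\operatorname{pd}_{R_{\mathbf k,n}} Q_{\mathbf k,n,N}$ is finite if and only if $n$ divides $N$.
   Context: For a field $\mathbf k$ and positive integers $n,N$: $R_{\mathbf k,n}=\mathbf k[x,y,z]/(x^n+y^n+z^n)$ and $Q_{\mathbf k,n,N}=R_{\mathbf k,n}/(x^N,y^N,z^N)$, regarded as an $R_{\mathbf k,n}$-module; $\operatorname{pd}$ denotes projective dimension. For a real number $\alpha$ not of the form $b+\frac12$ with $b\in\mathbb Z$, $\{\alpha\}$ denotes the integer closest to $\alpha$; thus for an integer $b$, $\{\frac b3\}$ equals $\frac b3,\frac{b-1}3,\frac{b+1}3$ according as $b\equiv 0,1,2 \pmod 3$. *)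

(* Defs.v *)
From HB Require Import structures.
From mathcomp Require Import all_boot all_order all_algebra.
From mathcomp Require Import mpoly.
Set Implicit Arguments. Unset Strict Implicit. Unset Printing Implicit Defensive.
Import Order.TTheory GRing.Theory Num.Theory.
Local Open Scope ring_scope.

Definition projective_mod (R : comNzRingType) (P : lmodType R) : Prop :=
  forall (A B : lmodType R) (f : {linear A -> B}) (g : {linear P -> B}),
    (forall b, exists a, f a = b) ->
    exists h : {linear P -> A}, forall x, f (h x) = g x.

Definition finite_pd (R : comNzRingType) (M : lmodType R) : Prop :=
  exists (m : nat) (P : nat -> lmodType R)
         (d : forall i : nat, {linear P i.+1 -> P i})
         (e : {linear P 0%N -> M}),
    [/\ (forall y : M, exists x, e x = y),
        (forall x : P 0%N, e x = 0 <-> exists y, d 0%N y = x),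
        (forall (i : nat) (x : P i.+1), d i x = 0 <-> exists y, d i.+1 y = x),
        (forall i, projective_mod (P i)) &
        (forall i, (m < i)%N -> forall x : P i, x = 0)].

Definition near_third (b : nat) : nat :=
  (if b %% 3 == 0 then b %/ 3
   else if b %% 3 == 1 then (b - 1) %/ 3
   else (b + 1) %/ 3)%N.

Definition vx (k : fieldType) : {mpoly k[3]} := 'X_(@Ordinal 3 0 isT).
Definition vy (k : fieldType) : {mpoly k[3]} := 'X_(@Ordinal 3 1 isT).
Definition vz (k : fieldType) : {mpoly k[3]} := 'X_(@Ordinal 3 2 isT).

Definition presents_Rkn (k : fieldType) (n : nat) (R : comNzRingType)
    (phi : {rmorphism {mpoly k[3]} -> R}) : Prop :=
  (forall r : R, exists p, phi p = r) /\
  (forall p, phi p = 0 <->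
     exists g, p = g * (vx k ^+ n + vy k ^+ n + vz k ^+ n)).

Definition presents_Q (k : fieldType) (N : nat) (R : comNzRingType)
    (phi : {rmorphism {mpoly k[3]} -> R}) (M : lmodType R)
    (pi : {linear R^o -> M}) : Prop :=
  (forall m : M, exists r, pi r = m) /\
  (forall r : R, pi r = 0 <->
     exists a b c : R, r = a * phi (vx k ^+ N) + b * phi (vy k ^+ N)
                            + c * phi (vz k ^+ N)).

(* Main.v *)
From Stdlib Require Import Classical.
Require Import Defs.
From HB Require Import structures.
From mathcomp Require Import all_boot all_order all_algebra.
From mathcomp Require Import mpoly freeg.
From mathcomp Require Import zify ring.
Import Order.TTheory GRing.Theory Num.Theory.
Local Open Scope ring_scope.

(* Idea. Write N = n th + r with r < n. Graded by exponents modulo n, the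
   syzygies of x^N, y^N, z^N over R split into the syzygies of X^a, Y^b, Z^c
   with a, b, c in {th, th + 1} over k[X, Y, Z] / (X + Y + Z), X = x^n, Y = y^n,
   Z = z^n. The latter are free of rank 2, and are studied as relations between
   univariate polynomials by setting X = t, Y = 1, Z = -(1 + t).

   A relation of degree d with 2 d + 2 <= a + b + c is, by the Mason-Stothers
   argument, up to common factors a pull-back along t |-> t^q of a relation of
   equal orders J, J odd, with q a power of the characteristic; J q is then
   within q / 3 of th. Conversely such J and q yield a primitive
   relation, a dimension count completes it to two relations with determinant
   (X Y Z)^th, one of them divisible by the (th + 1)-st powers, and these lift to a
   Hilbert-Burch resolution over R.

   If the projective dimension is finite and r > 0, the 2-periodic complex of
   the Koszul matrix factorization x^r x^(n-r) + y^r y^(n-r) + z^r z^(n-r)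
   stays exact after tensoring with M. A direct summand of that complex is the
   algebra on anticommuting D1, D2, D3 with D_i^(2 th + 1) = 0 and differential
   D = D1 + D2 + D3, where D^2 = X + Y + Z. It has one more dimension in degree
   3 th than in degree 3 th + 1, so D kills something nonzero in degree 3 th, which
   by exactness is D v; then X + Y + Z kills v, and v gives a relation of small
   degree as above. *)

Set Implicit Arguments. Unset Strict Implicit. Unset Printing Implicit Defensive.

(** * Relations between powers: dimension count *)

(* Sizes are generalized because convertible but syntactically different
   coercion paths would otherwise yield different atoms. *)
Ltac nat_lia :=
  repeat match goal with |- _ -> _ => let H := fresh "hyp" in intro H end;
  repeat match goal with H := _ |- _ => clearbody H end;
  repeat match goal with
  | H : ?P |- _ =>
    lazymatch type of P with Prop =>
      lazymatch P with
      | is_true (leq _ _) => revert H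
      | is_true (andb (leq _ _) (leq _ _)) => revert H
      | is_true (odd _) => revert H
      | @eq nat _ _ => revert H
      | not (@eq nat _ _) => revert H
      | _ => clear H
      end
    end
  end;
  repeat match goal with
  | |- context [size (polyseq ?v)] => move: (size v) => ?
  | |- context [mup ?a ?v] => move: (mup a v) => ?
  end;
  repeat match goal with |- _ -> _ => let H := fresh "hyp" in intro H end;
  lia.

Lemma linear_ker_neq0 (k : fieldType) m n (f : {linear 'rV[k]_m -> 'rV[k]_n}) :
  (n < m)%N -> exists2 v, v != 0 & f v = 0.
Proof.
move=> lt_nm; have : kermx (lin1_mx f) != 0.
  rewrite kermx_eq0 /row_free; apply/eqP => e.
  by have := rank_leq_col (lin1_mx f); rewrite e leqNgt lt_nm.
case/rowV0Pn => v /sub_kermxP vK v0; exists v => //.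
by rewrite -vK mul_rV_lin1.
Qed.

(** The pair [(A, B)] has [n1 + n2] free coefficients, while divisibility by [('X + 1) ^+ c] is the
    vanishing of a remainder with only [c] coefficients. *)
Lemma exists_syz (k : fieldType) n1 n2 c a b :
  (c < n1 + n2)%N ->
  exists A B : {poly k}, [/\ (A != 0) || (B != 0), (size A <= n1)%N,
    (size B <= n2)%N & ('X + 1) ^+ c %| 'X^a * A + 'X^b * B].
Proof.
move=> lt_c.
pose f (v : 'rV[k]_(n1 + n2)) : 'rV[k]_c :=
  poly_rV (('X^a * rVpoly (lsubmx v) + 'X^b * rVpoly (rsubmx v)) %% ('X + 1) ^+ c).
have flin : linear f.
  move=> l u v; rewrite /f -linearP -modpZl -modpD; congr (poly_rV (_ %% _)).
  by rewrite !linearP /= !mulrDr -!scalerAr scalerDr addrACA.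
pose F : {linear 'rV[k]_(n1 + n2) -> 'rV[k]_c} :=
  HB.pack f (GRing.isLinear.Build _ _ _ _ f flin).
have [v v0 fv] := linear_ker_neq0 F lt_c.
exists (rVpoly (lsubmx v)), (rVpoly (rsubmx v)); split; try exact: size_poly.
  rewrite -negb_and; apply: contra v0 => /andP[/eqP l0 /eqP r0].
  rewrite -[v]hsubmxK -[lsubmx v]rVpolyK -[rsubmx v]rVpolyK l0 r0.
  by rewrite !linear0 row_mx0.
rewrite /dvdp; apply/eqP.
set r := (_ %% _); have szr : (size r <= c)%N.
  rewrite -ltnS -(size_exp_XsubC c (-1 : k)) /r polyCN opprK ltn_modp expf_neq0 //.
  by rewrite -size_poly_eq0 size_XaddC.
by rewrite -(poly_rV_K szr) [poly_rV r]fv linear0.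
Qed.

(** * Mason-Stothers descent *)

Lemma deriv_eq0_comp (k : fieldType) p (w : {poly k}) :
  p \in [pchar k] -> w^`() = 0 -> exists v, w = v \Po 'X^p.
Proof.
move=> pk w0; have p0 := prime_gt0 (pcharf_prime pk).
exists (\poly_(i < size w) w`_(i * p)); apply/polyP => i.
rewrite coef_comp_poly_Xn // coef_poly.
have [pi|npi] := boolP (p %| i)%N.
  rewrite divnK //; case: ltnP => // h; rewrite nth_default //.
  exact: leq_trans h (leq_div i p).
case: i npi => [|i] npi; first by rewrite dvdn0 in npi.
have := congr1 (fun q : {poly k} => q`_i) w0.
rewrite coef_deriv coef0 -mulr_natr => /eqP; rewrite mulf_eq0 -(dvdn_pcharf pk).
by rewrite (negPf npi) orbF => /eqP.
Qed.

(** By Frobenius and [a ^+ p = a], the pull-back of ['X - a%:P] is [('X - a%:P) ^+ p], and the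
    cofactor stays nonzero at [a]. Applied at the fixed points 0 and -1. *)
Lemma mup_comp_Xp (k : fieldType) p (a : k) (v : {poly k}) :
  p \in [pchar k] -> a ^+ p = a -> v != 0 -> mup a (v \Po 'X^p) = (p * mup a v)%N.
Proof.
move=> pk ap v0; have [m [A]] := multiplicity_XsubC v a.
rewrite v0 /= => Aa ->.
have E : ('X - a%:P : {poly k}) \Po 'X^p = ('X - a%:P) ^+ p.
  have pk' : p \in [pchar {poly k}] by rewrite pchar_poly.
  rewrite -!(pFrobenius_autE pk') pFrobenius_autB_comm ?pFrobenius_autE; last exact: mulrC.
  by rewrite comp_polyB comp_polyX comp_polyC -polyC_exp ap.
rewrite comp_polyM rmorphXn /= E -exprM !mupMr ?mup_XsubCX ?eqxx //.
by rewrite /root horner_comp hornerXn ap.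
Qed.

Lemma dvdp_deriv (k : fieldType) (a : k) b (w : {poly k}) :
  ('X - a%:P) ^+ b %| w -> ('X - a%:P) ^+ b.-1 %| w^`().
Proof.
case: b => [|b] /=; first by move=> _; rewrite expr0 dvd1p.
case/dvdpP=> q ->; rewrite derivM deriv_exp dvdp_add //.
  by rewrite exprS mulrA dvdp_mulIr.
by rewrite mulrnAr -mulrnAl mulrA dvdp_mulIr.
Qed.

Lemma dvdp_wronskian (k : fieldType) (a : k) b (w1 w2 : {poly k}) :
  ('X - a%:P) ^+ b %| w1 -> ('X - a%:P) ^+ b.-1 %| w1 * w2^`() - w2 * w1^`().
Proof.
move=> h; apply: dvdp_sub; last by apply: dvdp_mull; apply: dvdp_deriv.
by apply/dvdp_mulr/(dvdp_trans _ h)/dvdp_exp2l/leq_pred.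
Qed.

Lemma deriv_eq0_dvdp (k : fieldType) (w : {poly k}) : w %| w^`() -> w^`() = 0.
Proof.
move=> h; apply/eqP; apply: contraT => n0.
have w0 : w != 0 by apply: contraNneq n0 => ->; rewrite linear0.
by have := dvdp_leq n0 h; rewrite leqNgt lt_size_deriv.
Qed.

Lemma comp_Xn_eq0 (k : fieldType) p (v : {poly k}) : (0 < p)%N ->
  (v \Po 'X^p == 0) = (v == 0).
Proof.
by move=> p0; rewrite comp_poly_eq0 // size_polyXn ltnS.
Qed.

Lemma size_comp_Xn (k : fieldType) p (v : {poly k}) : (0 < p)%N -> v != 0 ->
  size (v \Po 'X^p) = ((size v).-1 * p).+1.
Proof.
move=> p0 v0; have := size_comp_poly v ('X^p); rewrite size_polyXn /= => <-.
by rewrite prednK // lt0n size_poly_eq0 comp_Xn_eq0.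
Qed.

(* Mason-Stothers: a relation [w1 + w2 + w3 = 0] of degree [d] whose vanishing
   orders at 0, infinity and -1 add up to more than [2 d + 1] has zero
   Wronskian, so it is pulled back along [t |-> t^p]; iterate. *)
Lemma mason_descent (k : fieldType) d (w1 w2 : {poly k}) :
  coprimep w1 w2 -> w1 != 0 -> w2 != 0 -> w1 + w2 != 0 ->
  maxn (size w1) (size w2) = d.+1 ->
  (2 * d + 2 <= mup 0 w1 + (d.+1 - size w2) + mup (-1) (w1 + w2))%N ->
  exists p e J1 J2 J3 m, [/\ p \in [pchar k], (0 < e)%N,
    [/\ mup 0 w1 = p ^ e * J1, d.+1 - size w2 = p ^ e * J2 &
     mup (-1) (w1 + w2) = p ^ e * J3]%N,
    (J1 + J2 + J3 = 2 * m + 1)%N & d = (p ^ e * m)%N].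
Proof.
elim/ltn_ind: d w1 w2 => d IH w1 w2 cop n1 n2 n3 hd hb.
set b1 := mup 0 w1 in hb *; set b3 := mup (-1) _ in hb *.
have d1 : ('X - 0%:P) ^+ b1 %| w1 by rewrite -mup_geq.
have d3 : ('X - (-1)%:P) ^+ b3 %| w1 + w2 by rewrite -mup_geq.
have le1 : (b1 < size w1)%N.
  by have := dvdp_leq n1 d1; rewrite size_exp_XsubC.
have le3 : (b3 < size (w1 + w2)%R)%N.
  by have := dvdp_leq n3 d3; rewrite size_exp_XsubC.
have s3 : (size (w1 + w2)%R <= d.+1)%N by rewrite -hd size_polyD.
have s2 : (0 < size w2)%N by rewrite size_poly_gt0.
have d0 : (0 < d)%N by nat_lia.
pose W := w1 * w2^`() - w2 * w1^`().
have W0 : W = 0.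
  (* As [W] is also the Wronskian of [w1 + w2] and [w2], it has order at least [b1 - 1] at 0 and
     [b3 - 1] at -1; by hypothesis the sum exceeds its degree. *)
  apply/eqP; apply: contraT => nW.
  have e1 : ('X - 0%:P) ^+ b1.-1 %| W by apply: dvdp_wronskian.
  have e3 : ('X - (-1)%:P) ^+ b3.-1 %| W.
    have -> : W = (w1 + w2) * w2^`() - w2 * (w1 + w2)^`() by rewrite /W derivD; ring.
    exact: dvdp_wronskian.
  have cp : coprimep (('X - 0%:P) ^+ b1.-1) (('X - (-1)%:P : {poly k}) ^+ b3.-1).
    apply/coprimep_expl/coprimep_expr/coprimep_XsubC2.
    by rewrite subr0 oppr_eq0 oner_eq0.
  have : ('X - 0%:P) ^+ b1.-1 * ('X - (-1)%:P) ^+ b3.-1 %| W by rewrite Gauss_dvdp // e1.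
  move/(dvdp_leq nW); rewrite size_mul ?expf_neq0 ?polyXsubC_eq0 // !size_exp_XsubC.
  have szM (p q : {poly k}) : (size (p * q^`())%R <= (size p + size q).-2)%N.
    have [->|q0] := eqVneq q 0; first by rewrite linear0 mulr0 size_poly0.
    have := size_polyMleq p (q^`()); have := lt_size_deriv q0; nat_lia.
  have : (size W <= (size w1 + size w2).-2)%N.
    by rewrite (leq_trans (size_polyD _ _)) // size_polyN geq_max szM addnC szM.
  move: (size W) => sW. nat_lia.
have E : w1 * w2^`() = w2 * w1^`() by apply/eqP; rewrite -subr_eq0 -/W W0.
have D1 : w1^`() = 0.
  apply: deriv_eq0_dvdp; have : w1 %| w2 * w1^`() by rewrite -E dvdp_mulr.
  by rewrite Gauss_dvdpr.
have D2 : w2^`() = 0.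
  apply: deriv_eq0_dvdp; have : w2 %| w1 * w2^`() by rewrite E dvdp_mulr.
  by rewrite Gauss_dvdpr // coprimep_sym.
(* One of [w1], [w2] has positive degree and derivative zero, so this degree vanishes in [k]. *)
have [p pk] : exists p, p \in [pchar k].
  have : exists2 w : {poly k}, (1 < size w)%N & w^`() = 0.
    case: (ltnP 1 (size w1)) => h1; first by exists w1.
    by exists w2 => //; nat_lia.
  case=> w + w0; case sw: (size w) => [|[|m]] // _.
  apply: (@natf0_pchar k m.+1) => //; move: (congr1 (fun q : {poly k} => q`_m) w0).
  rewrite coef_deriv coef0 -(mulr_natr w`_m.+1) => /eqP; rewrite mulf_eq0 => /orP[|//].
  have -> : w`_m.+1 = lead_coef w by rewrite lead_coefE sw.
  by rewrite lead_coef_eq0 -size_poly_eq0 sw.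
have p0 := prime_gt0 (pcharf_prime pk); have p1 := prime_gt1 (pcharf_prime pk).
have [v1 E1] := deriv_eq0_comp pk D1; have [v2 E2] := deriv_eq0_comp pk D2.
have E3 : w1 + w2 = (v1 + v2) \Po 'X^p by rewrite comp_polyD -E1 -E2.
have m1 : v1 != 0 by rewrite -(comp_Xn_eq0 _ p0) -E1.
have m2 : v2 != 0 by rewrite -(comp_Xn_eq0 _ p0) -E2.
have m3 : v1 + v2 != 0 by rewrite -(comp_Xn_eq0 _ p0) -E3.
have B1 : b1 = (p * mup 0 v1)%N.
  by rewrite /b1 E1 mup_comp_Xp // expr0n; case: (p) p0.
have B3 : b3 = (p * mup (-1) (v1 + v2))%N.
  rewrite /b3 E3 mup_comp_Xp // exprNn_pchar ?expr1n //.
  by rewrite pnatE ?(pcharf_prime pk).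
have cv : coprimep v1 v2.
  apply/coprimepP => q q1 q2.
  have : q \Po 'X^p %| w1 by rewrite E1 dvdp_comp_poly.
  move/(coprimepP _ _ cop); rewrite E2 dvdp_comp_poly // => /(_ isT).
  have q0 : q != 0 by apply: contraNneq m1 => q0; rewrite q0 dvd0p in q1.
  rewrite -!size_poly_eq1 size_comp_Xn //= eqSS muln_eq0 (gtn_eqF p0) orbF.
  by have := size_poly_eq0 q; rewrite (negPf q0); case: (size q) => // -[].
have S1 := size_comp_Xn p0 m1; have S2 := size_comp_Xn p0 m2.
rewrite -E1 in S1; rewrite -E2 in S2.
have v1s : (0 < size v1)%N by rewrite size_poly_gt0.
have v2s : (0 < size v2)%N by rewrite size_poly_gt0.
pose d' := (maxn (size v1) (size v2)).-1.
have hd' : maxn (size v1) (size v2) = d'.+1 by rewrite /d' prednK // leq_max v1s.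
have dd : d = (p * d')%N.
  apply/succn_inj; rewrite -hd S1 S2 /d'.
  rewrite (mulnC p); have [h|/ltnW h] := leqP (size v1) (size v2).
    by have := leq_mul (leq_sub2r 1 h) (leqnn p); rewrite !subn1; nat_lia.
  by have := leq_mul (leq_sub2r 1 h) (leqnn p); rewrite !subn1; nat_lia.
have B2 : (d.+1 - size w2 = p * (d'.+1 - size v2))%N.
  by rewrite S2 subSS dd (mulnC _.-1) -mulnBr -[in RHS](prednK v2s) subSS.
move: hb; rewrite B1 B2 B3 dd.
set c1 := mup 0 v1; set c2 := (_ - _)%N; set c3 := mup (-1) _ => hb.
have hc : (2 * d' < c1 + c2 + c3)%N by rewrite -(ltn_pmul2l p0); nat_lia.
(* After division by [p] the orders still add up to at least [2 * d' + 1]. With equality the descent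
   stops with exponent 1; otherwise it continues in degree [d' < d]. *)
case: (ltngtP (c1 + c2 + c3) (2 * d' + 1)) => hc'; [nat_lia| |].
  have ltd : (d' < d)%N.
    by move: d0; rewrite dd muln_gt0 => /andP[_ d'0]; rewrite ltn_Pmull.
  have hb' : (2 * d' + 2 <= mup 0 v1 + (d'.+1 - size v2) + mup (-1) (v1 + v2))%N.
    by rewrite -/c1 -/c2 -/c3; nat_lia.
  have [p' [e [J1 [J2 [J3 [m [pk' e0 [h1 h2 h3] hJ hm]]]]]]] := IH d' ltd v1 v2 cv m1 m2 m3 hd' hb'.
  have ep : p' = p by have := pcharf_eq pk p'; rewrite pk' => /esym/eqP.
  exists p, e.+1, J1, J2, J3, m; rewrite pk -/c1 -/c2 -/c3 in h1 h2 h3 *.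
  by split=> //; rewrite ?h1 ?h2 ?h3 ?hm ep expnS ?mulnA.
exists p, 1%N, c1, c2, c3, d'; rewrite expn1; split=> //.
Qed.

(* Dehomogenization [X = t, Y = 1, Z = -(1 + t)] of the degree [d] part of the
   syzygies of [X^a, Y^b, Z^c] over [k[X, Y, Z] / (X + Y + Z)]: the multiples of
   [X^a, Y^b, Z^c] are [u, v, -(u + v)]. *)
Definition syz (k : fieldType) (a b c d : nat) (u v : {poly k}) : Prop :=
  [/\ 'X^a %| u, ('X + 1) ^+ c %| u + v, (size u <= d.+1)%N
    & (size v <= d.+1 - b)%N].

Lemma mup0_geq (k : fieldType) n (q : {poly k}) : q != 0 ->
  (n <= mup 0 q)%N = ('X^n %| q).
Proof. by move=> q0; rewrite mup_geq // subr0. Qed.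

Lemma mupN1_geq (k : fieldType) n (q : {poly k}) : q != 0 ->
  (n <= mup (-1) q)%N = (('X + 1) ^+ n %| q).
Proof. by move=> q0; rewrite mup_geq // polyCN opprK. Qed.

Lemma coprimep_X_X1 (k : fieldType) a c : coprimep ('X^a : {poly k}) (('X + 1) ^+ c).
Proof.
apply/coprimep_expl/coprimep_expr.
have := @coprimep_XsubC2 k 0 (-1); rewrite !subr0 polyCN opprK oppr_eq0 oner_eq0.
by apply.
Qed.

Lemma size_X1_exp (k : fieldType) c : size (('X + 1 : {poly k}) ^+ c) = c.+1.
Proof. by have := size_exp_XsubC c (-1 : k); rewrite polyCN opprK. Qed.

Lemma X1_exp_neq0 (k : fieldType) c : ('X + 1 : {poly k}) ^+ c != 0.
Proof. by rewrite -size_poly_eq0 size_X1_exp. Qed.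

Lemma dvd_X_X1_size (k : fieldType) a c (w : {poly k}) : w != 0 ->
  'X^a %| w -> ('X + 1) ^+ c %| w -> (a + c < size w)%N.
Proof.
move=> w0 h1 h2.
have : 'X^a * ('X + 1) ^+ c %| w by rewrite Gauss_dvdp ?coprimep_X_X1 // h1.
move/(dvdp_leq w0); rewrite size_mul ?X1_exp_neq0 -?size_poly_eq0 ?size_polyXn //.
by rewrite size_X1_exp addSn addnS.
Qed.

(** In this range [d] is smaller than the sum of any two of the nearly equal exponents, so if one of
    the three multiples vanished, the other two would have too many zeros among 0, infinity and
    -1. *)
Lemma syz_neq0 (k : fieldType) th a b c d (u v : {poly k}) :
  syz a b c d u v -> (u != 0) || (v != 0) ->
  (th <= a <= th.+1)%N -> (th <= b <= th.+1)%N -> (th <= c <= th.+1)%N ->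
  (2 * d + 2 <= a + b + c)%N -> [/\ u != 0, v != 0 & u + v != 0].
Proof.
case=> h1 h2 h3 h4 uv ha hb hc hd.
have u0 : u != 0.
  apply/eqP => u0; move: uv h2; rewrite u0 eqxx add0r /= => v0 /(dvdp_leq v0).
  by rewrite size_X1_exp; nat_lia.
have v0 : v != 0.
  apply/eqP => v0; move: h2; rewrite v0 addr0 => h2.
  by have := dvd_X_X1_size u0 h1 h2; nat_lia.
split=> //; apply/eqP => uv0.
have : 'X^a %| v by rewrite -(dvdp_addr _ h1) uv0 dvdp0.
by move/(dvdp_leq v0); rewrite size_polyXn; nat_lia.
Qed.

(** A coprime relation of degree [d] whose orders at 0, -1 and infinity are all exactly [B];
    [psyz_size2] is the order at infinity. *)
Record primitive_syz (k : fieldType) (B d : nat) (w1 w2 : {poly k}) : Prop := {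
  psyz_cop : coprimep w1 w2;
  psyz_neq1 : w1 != 0;
  psyz_neq2 : w2 != 0;
  psyz_neq3 : w1 + w2 != 0;
  psyz_ord0 : mup 0 w1 = B;
  psyz_ordN1 : mup (-1) (w1 + w2) = B;
  psyz_size1 : size w1 = d.+1;
  psyz_size2 : (size w2 + B)%N = d.+1 }.

(** After division by the gcd [mason_descent] still applies, since each order lost at 0 or -1 also
    lowers the degree by one. The inequalities place [J * p ^ e] within about [p ^ e / 3] of
    [th]. *)
Lemma syz_primitive (k : fieldType) th a b c d (u v : {poly k}) :
  syz a b c d u v -> (u != 0) || (v != 0) ->
  (th <= a <= th.+1)%N -> (th <= b <= th.+1)%N -> (th <= c <= th.+1)%N ->
  (2 * d + 2 <= a + b + c)%N ->
  exists p e J d' w1 w2,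
  [/\ p \in [pchar k], (0 < e)%N, odd J,
     (3 * (J * p ^ e) <= p ^ e + 1 + 3 * th)%N /\ (3 * th + 2 <= 3 * (J * p ^ e) + p ^ e)%N
   & (2 * d' + p ^ e = 3 * (J * p ^ e))%N /\ @primitive_syz k (J * p ^ e) d' w1 w2].
Proof.
move=> S uv ha hb hc hd.
have [u0 v0 w0] := syz_neq0 S uv ha hb hc hd; case: S => h1 h2 h3 h4.
pose G := gcdp u v.
have G0 : G != 0 by rewrite gcdp_eq0 (negPf u0).
have /dvdpP[w1 E1] := dvdp_gcdl u v; have /dvdpP[w2 E2] := dvdp_gcdr u v.
rewrite -/G in E1 E2.
have n1 : w1 != 0 by apply: contraNneq u0 => z; rewrite E1 z mul0r.
have n2 : w2 != 0 by apply: contraNneq v0 => z; rewrite E2 z mul0r.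
have E3 : u + v = (w1 + w2) * G by rewrite mulrDl -E1 -E2.
have n3 : w1 + w2 != 0 by apply: contraNneq w0 => z; rewrite E3 z mul0r.
have cop : coprimep w1 w2.
  have : coprimep (u %/ G) (v %/ G) by apply: coprimep_div_gcd; rewrite u0.
  by rewrite E1 E2 !mulpK.
have s1p : (0 < size w1)%N by rewrite size_poly_gt0.
have s2p : (0 < size w2)%N by rewrite size_poly_gt0.
have sGp : (0 < size G)%N by rewrite size_poly_gt0.
pose d' := (maxn (size w1) (size w2)).-1.
have hd' : maxn (size w1) (size w2) = d'.+1 by rewrite /d' prednK // leq_max s1p.
have su : size u = (size w1 + size G).-1 by rewrite E1 size_mul.
have sv : size v = (size w2 + size G).-1 by rewrite E2 size_mul.
have g1 : (a <= mup 0 w1 + mup 0 G)%N by rewrite -mupM // -E1 mup0_geq.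
have g3 : (c <= mup (-1) (w1 + w2) + mup (-1) G)%N by rewrite -mupM // -E3 mupN1_geq.
have gG : (mup 0 G + mup (-1) G < size G)%N.
  by apply: dvd_X_X1_size => //; rewrite -?mup0_geq -?mupN1_geq.
have hM : (2 * d' + 2 <= mup 0 w1 + (d'.+1 - size w2) + mup (-1) (w1 + w2))%N by nat_lia.
have [p [e [J1 [J2 [J3 [m [pk e0 [b1 b2 b3] hJ hm]]]]]]] := mason_descent cop n1 n2 n3 hd' hM.
have p1 := prime_gt1 (pcharf_prime pk).
have q2 : (2 <= p ^ e)%N by rewrite (leq_trans p1) // -{1}(expn1 p) leq_pexp2l // ltnW.
have lt_J i j : (i < j)%N -> (p ^ e * i + p ^ e <= p ^ e * j)%N.
  by move=> h; rewrite -mulnSr leq_mul2l h orbT.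
have hB : (p ^ e * J1 + p ^ e * J2 + p ^ e * J3 = 2 * d' + p ^ e)%N.
  by rewrite -!mulnDr hJ hm; nat_lia.
have s2d : (size w2 <= d'.+1)%N by rewrite -hd' leq_maxr.
have sGd : (d' + size G <= d.+1)%N.
  by clear b1 b2 b3 hB hm hM; nat_lia.
(* Different orders would differ by at least [p ^ e]. The orders fall short of [a], [b], [c] by at
   most [d - d'] in total, so two of these exponents would differ by more than one. *)
have nlt12 : ~~ (J1 < J2)%N by apply/negP => /lt_J h; nat_lia.
have nlt13 : ~~ (J1 < J3)%N by apply/negP => /lt_J h; nat_lia.
have nlt21 : ~~ (J2 < J1)%N by apply/negP => /lt_J h; nat_lia.
have nlt23 : ~~ (J2 < J3)%N by apply/negP => /lt_J h; nat_lia.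
have nlt31 : ~~ (J3 < J1)%N by apply/negP => /lt_J h; nat_lia.
have e2 : J2 = J1 by clear -nlt12 nlt21; lia.
have e3 : J3 = J1 by clear -nlt13 nlt31; lia.
rewrite e2 e3 in b2 b3 hJ hB.
have J1o : odd J1 by clear -hJ; lia.
have sw1 : size w1 = d'.+1.
  (* [J1] is odd, hence positive, so [w2] has degree below [d'] and [w1] attains the maximum. *)
  by move: (lt_J 0%N J1); rewrite muln0; clear hB hm hM g1 g3; nat_lia.
exists p, e, J1, d', w1, w2; split=> //.
- by rewrite mulnC; split; nat_lia.
split; first by rewrite (mulnC J1); nat_lia.
by split=> //; rewrite (mulnC J1) // -b2; nat_lia.
Qed.

(** * Completing a syzygy to a basis *)

Lemma size_mul_leq (k : fieldType) (p q : {poly k}) m n :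
  (size p <= m.+1)%N -> (size q <= n)%N -> (size (p * q)%R <= m + n)%N.
Proof.
move=> hp hq; have [->|q0] := eqVneq q 0; first by rewrite mulr0 size_poly0.
have : (0 < size q)%N by rewrite size_poly_gt0.
by have := size_polyMleq p q; nat_lia.
Qed.

Lemma parallel_factor (k : fieldType) (u v u' v' : {poly k}) :
  (u != 0) || (v != 0) -> u * v' = v * u' ->
  exists al be u0 v0, [/\ coprimep al be, u = be * u0, v = be * v0,
    u' = al * u0 & v' = al * v0].
Proof.
wlog u0 : u v u' v' / u != 0 => [H uv e|_ e].
  have [u0|u0] := eqVneq u 0; last exact: H.
  have v0 : v != 0 by move: uv; rewrite u0 eqxx.
  have [al [be [x [y [h1 h2 h3 h4 h5]]]]] := H v u v' u' v0 (introT orP (or_introl v0)) (esym e).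
  by exists al, be, y, x.
pose g := gcdp u u'.
have g0 : g != 0 by rewrite gcdp_eq0 (negPf u0).
have /dvdpP[be E1] := dvdp_gcdl u u'; have /dvdpP[al E2] := dvdp_gcdr u u'.
rewrite -/g in E1 E2.
have be0 : be != 0 by apply: contraNneq u0 => z; rewrite E1 z mul0r.
have cop : coprimep be al.
  have : coprimep (u %/ g) (u' %/ g) by apply: coprimep_div_gcd; rewrite u0.
  by rewrite E1 E2 !mulpK.
have e' : be * v' = al * v.
  by apply: (mulIf g0); rewrite mulrAC -E1 e E2; ring.
have /dvdpP[v0 Ev] : be %| v by rewrite -(Gauss_dvdpr _ cop) -e' dvdp_mulr.
exists al, be, g, v0; rewrite coprimep_sym cop E1 E2 Ev mulrC; split=> //.
  by rewrite mulrC.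
by apply: (mulfI be0); rewrite e' Ev; ring.
Qed.

(** The syzygy is no multiple of one of smaller degree. The case [g = 1] matters: it excludes a
    common zero at infinity, which dehomogenization hides. *)
Definition saturated_syz (k : fieldType) a b c d (u v : {poly k}) : Prop :=
  forall g u' v' m, u = g * u' -> v = g * v' -> syz a b c m u' v' -> (d <= m)%N.

(** Both syzygies are multiples of one pair, which by Bezout is a combination of them and so a
    syzygy itself; saturation makes the factor [be] constant. Saturation also makes [u] or [v]
    attain its maximal size, which bounds [al]. *)
Lemma saturated_syz_parallel (k : fieldType) a b c d e (u v u' v' : {poly k}) :
  syz a b c d u v -> (u != 0) || (v != 0) -> saturated_syz a b c d u v ->
  syz a b c e u' v' -> u * v' = v * u' ->
  exists al, [/\ u' = al * u, v' = al * v & (size al <= e.+1 - d)%N].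
Proof.
move=> [h1 h2 h3 h4] uv sat [h1' h2' h3' h4'] par.
have [al [be [x [y [cop E1 E2 E1' E2']]]]] := parallel_factor uv par.
have be0 : be != 0.
  by apply: contraTneq uv => z; rewrite E1 E2 z !mul0r eqxx.
have [[s t] /= bez] := Bezout_eq1_coprimepP _ _ cop.
have szx : (size u = if x == 0 then 0%N else (size be + size x).-1).
  by rewrite E1; case: eqVneq => [->|x0]; rewrite ?mulr0 ?size_poly0 // size_mul.
have szy : (size v = if y == 0 then 0%N else (size be + size y).-1).
  by rewrite E2; case: eqVneq => [->|y0]; rewrite ?mulr0 ?size_poly0 // size_mul.
have sbe : (0 < size be)%N by rewrite size_poly_gt0.
have Ex : x = s * u' + t * u by rewrite E1 E1' !mulrA -mulrDl bez mul1r.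
have Ey : y = s * v' + t * v by rewrite E2 E2' !mulrA -mulrDl bez mul1r.
have S : syz a b c (d - (size be).-1) x y.
  split.
  - by rewrite Ex dvdp_add // dvdp_mull.
  - rewrite Ex Ey addrACA -!mulrDr dvdp_add // dvdp_mull //.
  - case: eqVneq szx => [->|x0] szx; first by rewrite size_poly0.
    have : (0 < size x)%N by rewrite size_poly_gt0.
    by clear szy; nat_lia.
  - case: eqVneq szy => [->|y0] szy; first by rewrite size_poly0.
    have : (0 < size y)%N by rewrite size_poly_gt0.
    by clear szx; nat_lia.
have be1 : size be = 1%N.
  have := sat _ _ _ _ E1 E2 S.
  move: uv; rewrite E1 E2 !mulf_eq0 !negb_or be0 /= => /orP[x0|y0].
    have : (0 < size x)%N by rewrite size_poly_gt0.
    by move: szx; rewrite (negPf x0) => szx; clear szy; nat_lia.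
  have : (0 < size y)%N by rewrite size_poly_gt0.
  by move: szy; rewrite (negPf y0) => szy; clear szx; nat_lia.
have /size_poly1P[l l0 El] := (introT eqP be1).
pose ga := l^-1 *: al.
have Eu : u' = ga * u by rewrite E1' E1 El mul_polyC -scalerAl -scalerAr scalerA mulVf // scale1r.
have Ev : v' = ga * v by rewrite E2' E2 El mul_polyC -scalerAl -scalerAr scalerA mulVf // scale1r.
exists ga; split=> //; have [->|ga0] := eqVneq ga 0; first by rewrite size_poly0.
have sga : (0 < size ga)%N by rewrite size_poly_gt0.
have szu : u != 0 -> (size u' = (size ga + size u).-1)%N by move=> u0; rewrite Eu size_mul.
have szv : v != 0 -> (size v' = (size ga + size v).-1)%N by move=> v0; rewrite Ev size_mul.
have [d0|d0] := posnP d.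
  case/orP: uv => [u0|v0].
    by have := szu u0; have := u0; rewrite -size_poly_gt0; nat_lia.
  by have := szv v0; have := v0; rewrite -size_poly_gt0; nat_lia.
have [hu|hu] := ltnP d (size u).
  have u0 : u != 0 by rewrite -size_poly_gt0; nat_lia.
  by have := szu u0; nat_lia.
have [hv|hv] := leqP (size v) (d - b).
  have : (d <= d.-1)%N; last by nat_lia.
  by apply: (sat 1 u v); rewrite ?mul1r //; split=> //; nat_lia.
have v0 : v != 0 by rewrite -size_poly_gt0; nat_lia.
by have := szv v0; nat_lia.
Qed.

(* Syzygies of the complementary degree [e = a + b + c - d] have dimension at
   least [e - d + 2]; the multiples of [(u, v)] among them are excluded by
   [e - d + 1] vanishing conditions at 0. *)
Lemma syz_complement (k : fieldType) a b c d (u v : {poly k}) :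
  syz a b c d u v -> (u != 0) || (v != 0) -> saturated_syz a b c d u v ->
  (2 * d <= (a + b + c).+1)%N ->
  exists u' v' l, [/\ l != 0, syz a b c (a + b + c - d) u' v' &
    u * v' - v * u' = l *: ('X^a * ('X + 1) ^+ c)].
Proof.
move=> S uv sat hd; have [h1 h2 h3 h4] := S.
(* For any non-parallel pair in these degrees the determinant is divisible by ['X^a * ('X + 1) ^+ c]
   and has at most the same degree, so the quotient is a nonzero constant. *)
suff [u' [v' [S' npar]]] : exists u' v', syz a b c (a + b + c - d) u' v' /\ u * v' - v * u' != 0.
  have [h1' h2' h3' h4'] := S'; set D := _ - _ in npar.
  have : 'X^a * ('X + 1) ^+ c %| D.
    rewrite Gauss_dvdp ?coprimep_X_X1 // /D; apply/andP; split.
      by apply: dvdp_sub; [apply: dvdp_mulr | apply: dvdp_mull].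
    have -> : u * v' - v * u' = (u + v) * v' - v * (u' + v') by ring.
    by apply: dvdp_sub; [apply: dvdp_mulr | apply: dvdp_mull].
  case/dvdpP=> l El.
  have P0 : 'X^a * ('X + 1) ^+ c != 0 :> {poly k}.
    by rewrite mulf_neq0 ?X1_exp_neq0 // -size_poly_gt0 size_polyXn.
  have l0 : l != 0 by apply: contraNneq npar => z; rewrite El z mul0r.
  have sP : size ('X^a * ('X + 1) ^+ c : {poly k}) = (a + c).+1.
    rewrite size_mul ?X1_exp_neq0 -?size_poly_gt0 ?size_polyXn //.
    by rewrite size_X1_exp addSn addnS.
  have szD : (size D <= (a + c).+1)%N.
    rewrite /D (leq_trans (size_polyD _ _)) // size_polyN geq_max; apply/andP; split.
      have [v0|] := posnP (size v').
        by have /eqP := v0; rewrite size_poly_eq0 => /eqP ->; rewrite mulr0 size_poly0.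
      by have := size_mul_leq h3 h4'; nat_lia.
    have [v0|] := posnP (size v).
      by have /eqP := v0; rewrite size_poly_eq0 => /eqP ->; rewrite mul0r size_poly0.
    by rewrite mulrC; have := size_mul_leq h3' h4; nat_lia.
  have sl : size l = 1%N.
    move: szD; rewrite El size_mul // sP; have := l0; rewrite -size_poly_gt0.
    by nat_lia.
  have /size_poly1P[x x0 Ex] := (introT eqP sl).
  by exists u', v', x; split=> //; rewrite -/D El Ex mul_polyC.
pose K := ((a + b + c).+1 - 2 * d)%N; have hK : K = ((a + b + c).+1 - 2 * d)%N by [].
have dE : (d <= a + b + c)%N by nat_lia.
(* The [K] conditions at 0 go to the component whose order is known: the first one if [u] has order
   exactly [a], otherwise the second one, as saturation then prevents [v] from vanishing at 0. A
   parallel solution would have a factor [al] divisible by ['X^K] but of size at most [K]. *)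
have [hX|hX] := boolP ('X^(a.+1) %| u); last first.
  have u0 : u != 0 by apply: contraNneq hX => ->; rewrite dvdp0.
  have da : (a <= d)%N by have := dvdp_leq u0 h1; rewrite size_polyXn; nat_lia.
  have [|A [B [AB sA sB dv]]] := @exists_syz k (d - a) (a + c + 1 - d) c (a + K) 0.
    by nat_lia.
  exists ('X^(a + K) * A), B; rewrite expr0 mul1r in dv.
  have S' : syz a b c (a + b + c - d) ('X^(a + K) * A) B.
    split=> //; first by rewrite exprD -mulrA dvdp_mulIl.
      have := @size_mul_leq k 'X^(a + K) A (a + K) (d - a); rewrite size_polyXn.
      by move=> /(_ (leqnn _) sA); nat_lia.
    by nat_lia.
  split=> //; apply/eqP => /eqP; rewrite subr_eq0 => /eqP par.
  have [al [E1 E2 sal]] := saturated_syz_parallel S uv sat S' par.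
  have al0 : al != 0.
    apply: contraTneq AB => z; move: E1 E2; rewrite z !mul0r => /eqP + ->.
    by rewrite mulf_eq0 expf_eq0 polyX_eq0 andbF /= => ->; rewrite eqxx.
  have : (a + K <= mup 0 (al * u))%N by rewrite mup0_geq ?mulf_neq0 // -E1 dvdp_mulIl.
  rewrite mupM // => m1.
  have m2 : (mup 0 u < a.+1)%N by rewrite ltnNge mup0_geq.
  have : 'X^K %| al by rewrite -mup0_geq //; nat_lia.
  by move/(dvdp_leq al0); rewrite size_polyXn; nat_lia.
have hv : ~~ ('X %| v)%R.
  apply/negP => /dvdpP[v' Ev]; have /dvdpP[u' Eu] := hX.
  have Eu' : u = 'X * (u' * 'X^a) by rewrite Eu exprS mulrCA.
  have Ev' : v = 'X * v' by rewrite Ev mulrC.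
  have sXM (q : {poly k}) : (size ('X * q)%R).-1 = size q.
    by have [->|q0] := eqVneq q 0; rewrite ?mulr0 ?size_poly0 // mulrC size_mulX.
  have d0 : (0 < d)%N.
    case/orP: uv => [u0|v0].
      by have := dvdp_leq u0 hX; rewrite size_polyXn; nat_lia.
    have : (1 < size v)%N.
      by have := dvdp_leq v0 (_ : 'X %| v); rewrite size_polyX Ev dvdp_mulIr; apply.
    by nat_lia.
  have : (d <= d.-1)%N; last by nat_lia.
  apply: (sat _ _ _ _ Eu' Ev'); split.
  - by rewrite dvdp_mulIr.
  - move: h2; rewrite Eu' Ev' -mulrDr Gauss_dvdpr // coprimep_sym.
    by have := @coprimep_X_X1 k 1 c; rewrite expr1.
  - by rewrite -sXM -Eu'; nat_lia.
  - by rewrite -sXM -Ev'; nat_lia.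
have v0 : v != 0 by apply: contraNneq hv => ->; rewrite dvdp0.
have db : (b <= d)%N by have := v0; rewrite -size_poly_gt0; nat_lia.
have [|A [B [AB sA sB dv]]] := @exists_syz k (b + c + 1 - d) (d - b) c a K.
  by nat_lia.
exists ('X^a * A), ('X^K * B).
have S' : syz a b c (a + b + c - d) ('X^a * A) ('X^K * B).
  split=> //; first by rewrite dvdp_mulIl.
    have := @size_mul_leq k ('X^a) A a (b + c + 1 - d); rewrite size_polyXn.
    have [z|] := posnP (size A).
      by have /eqP := z; rewrite size_poly_eq0 => /eqP ->; rewrite mulr0 size_poly0.
    by move=> sA0 /(_ (leqnn _) sA); nat_lia.
  have := @size_mul_leq k ('X^K) B K (d - b); rewrite size_polyXn.
  by move=> /(_ (leqnn _) sB); nat_lia.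
split=> //; apply/eqP => /eqP; rewrite subr_eq0 => /eqP par.
have [al [E1 E2 sal]] := saturated_syz_parallel S uv sat S' par.
have al0 : al != 0.
  apply: contraTneq AB => z; move: E1 E2; rewrite z !mul0r => /eqP + /eqP.
  by rewrite !mulf_eq0 !expf_eq0 polyX_eq0 !andbF /= => -> ->.
have : 'X^K %| al.
  rewrite -(@Gauss_dvdpl _ _ v) -?E2 ?dvdp_mulIl // coprimep_expl // coprimep_sym.
  by rewrite coprimepX -[0]/(0 : k) -dvdp_XsubCl subr0.
by move/(dvdp_leq al0); rewrite size_polyXn; nat_lia.
Qed.

(** * Construction of basis pairs *)

Lemma minimal_nat (P : nat -> Prop) n : P n ->
  exists m, [/\ P m, (m <= n)%N & forall i, P i -> (m <= i)%N].
Proof.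
elim/ltn_ind: n => n IH Pn.
have [[m [lt_mn Pm]]|no] := classic (exists m, (m < n)%N /\ P m).
  have [i [Pi lei mini]] := IH m lt_mn Pm.
  by exists i; split=> //; apply: leq_trans lei (ltnW lt_mn).
exists n; split=> // i Pi; rewrite leqNgt; apply/negP => lt_in.
by apply: no; exists i.
Qed.

(** Dehomogenized Hilbert-Burch data: the determinant is [(X * Y * Z) ^ th] up to a unit, with
    [Y = 1]. It is used with [rho] equal to [th] or [th + 1]. *)
Definition basis_pair (k : fieldType) (th rho : nat) : Prop :=
  exists d e (u1 u2 v1 v2 : {poly k}) l,
  [/\ l != 0, syz rho rho rho d u1 u2, syz th th th e v1 v2,
     (d + e = 3 * th)%N & u1 * v2 - u2 * v1 = l *: ('X^th * ('X + 1) ^+ th)].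

Lemma exists_syz_diag (k : fieldType) a d : (a <= d.+1)%N -> (3 * a < 2 * d + 2)%N ->
  exists u v : {poly k}, (u != 0) || (v != 0) /\ syz a a a d u v.
Proof.
move=> ad hd.
have [|A [B [AB sA sB dv]]] := @exists_syz k (d.+1 - a) (d.+1 - a) a a 0; first by nat_lia.
exists ('X^a * A), B; rewrite expr0 mul1r in dv; split.
  by apply: contraTT AB; rewrite !negb_or !negbK mulf_eq0 expf_eq0 polyX_eq0 andbF.
split=> //; first by rewrite dvdp_mulIl.
have := @size_mul_leq k ('X^a) A a (d.+1 - a); rewrite size_polyXn.
by move=> /(_ (leqnn _) sA); nat_lia.
Qed.

(** A syzygy of least degree is saturated, and a dimension count puts this degree at or below
    [3 * th / 2], where [syz_complement] applies. *)
Lemma basis_pair_refl (k : fieldType) th : basis_pair k th th.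
Proof.
pose P d := exists u v : {poly k}, (u != 0) || (v != 0) /\ syz th th th d u v.
have P0 : P (3 * th)./2 by apply: exists_syz_diag; nat_lia.
have [d [[u [v [uv S]]] led mind]] := minimal_nat P0.
have sat : saturated_syz th th th d u v.
  move=> g u' v' m Eu Ev S'; apply: mind; exists u', v'; split=> //.
  apply: contraTT uv; rewrite !negb_or !negbK Eu Ev => /andP[/eqP-> /eqP->].
  by rewrite mulr0 eqxx.
have [|u' [v' [l [l0 S' det]]]] := syz_complement S uv sat; first by nat_lia.
exists d, (th + th + th - d)%N, u, v, u', v', l; split=> //; nat_lia.
Qed.

Lemma syz_weaken (k : fieldType) a a' d (u v : {poly k}) : (a' <= a)%N ->
  syz a a a d u v -> syz a' a' a' d u v.
Proof.
move=> ha [h1 h2 h3 h4]; split=> //.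
- exact: dvdp_trans (dvdp_exp2l _ ha) h1.
- exact: dvdp_trans (dvdp_exp2l _ ha) h2.
- by nat_lia.
Qed.

Lemma size_XX1_mul (k : fieldType) t (q : {poly k}) : q != 0 ->
  size ('X^t * ('X + 1) ^+ t * q) = (2 * t + size q)%N.
Proof.
move=> q0; have X0 : ('X^t : {poly k}) != 0 by rewrite expf_neq0 ?polyX_eq0.
rewrite size_mul ?mulf_neq0 ?X1_exp_neq0 // size_mul ?X1_exp_neq0 //.
by rewrite size_polyXn size_X1_exp; nat_lia.
Qed.

(** This is multiplication by [(X * Y * Z) ^ t] up to sign; the factor [Y ^ t] is 1 and is visible
    only in the degree. *)
Lemma syz_mul_XYZ (k : fieldType) t a d (u v : {poly k}) : syz a a a d u v ->
  syz (a + t) (a + t) (a + t) (d + 3 * t) ('X^t * ('X + 1) ^+ t * u)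
      ('X^t * ('X + 1) ^+ t * v).
Proof.
move=> [h1 h2 h3 h4]; split.
- rewrite addnC exprD -mulrA; apply: dvdp_mul => //; exact: dvdp_mull.
- rewrite -mulrDr addnC exprD mulrAC mulrC; apply: dvdp_mul => //; exact: dvdp_mull.
- have [->|u0] := eqVneq u 0; first by rewrite mulr0 size_poly0.
  by rewrite size_XX1_mul //; nat_lia.
- have [->|v0] := eqVneq v 0; first by rewrite mulr0 size_poly0.
  by rewrite size_XX1_mul //; have := v0; rewrite -size_poly_gt0; nat_lia.
Qed.

(** Frobenius turns ['X + 1] composed with ['X^(p ^ e)] into [('X + 1) ^+ (p ^ e)], so all three
    orders are multiplied by [p ^ e]. *)
Lemma syz_comp_Xq (k : fieldType) p e a d (u v : {poly k}) : p \in [pchar k] ->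
  syz a a a d u v ->
  syz (a * p ^ e) (a * p ^ e) (a * p ^ e) (d * p ^ e) (u \Po 'X^(p ^ e)) (v \Po 'X^(p ^ e)).
Proof.
move=> pk [h1 h2 h3 h4]; have pp := pcharf_prime pk.
have q0 : (0 < p ^ e)%N by rewrite expn_gt0 prime_gt0.
have X1 : ('X + 1 : {poly k}) \Po 'X^(p ^ e) = ('X + 1) ^+ (p ^ e).
  rewrite exprDn_pchar ?expr1n ?comp_polyD ?comp_polyX ?comp_polyC //.
  by rewrite pnatX pnatE // pchar_poly pk.
split.
- by have := dvdp_comp_poly 'X^(p ^ e) h1; rewrite comp_Xn_poly -exprM mulnC.
- by have := dvdp_comp_poly 'X^(p ^ e) h2; rewrite rmorphXn /= X1 comp_polyD -exprM mulnC.
- have [->|u0] := eqVneq u 0; first by rewrite comp_poly0 size_poly0.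
  rewrite size_comp_Xn // ltnS leq_mul2r orbC; apply/orP; left; nat_lia.
- have [->|v0] := eqVneq v 0; first by rewrite comp_poly0 size_poly0.
  have v1 : (0 < size v)%N by rewrite size_poly_gt0.
  rewrite size_comp_Xn //.
  have : ((size v).-1 * p ^ e + a * p ^ e <= d * p ^ e)%N.
    by rewrite -mulnDl leq_mul2r orbC; apply/orP; left; nat_lia.
  by nat_lia.
Qed.

Lemma dvdp_coprime_size1 (k : fieldType) (g u v : {poly k}) :
  coprimep u v -> g %| u -> g %| v -> size g = 1%N.
Proof. by move=> cop gu gv; apply/eqP; rewrite size_poly_eq1; apply: (coprimepP _ _ cop). Qed.

Lemma size_mul1 (k : fieldType) (g u : {poly k}) : size g = 1%N -> size (g * u) = size u.
Proof. by move=> /eqP/size_poly1P[l l0 ->]; rewrite mul_polyC size_scale. Qed.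

Lemma primitive_syz_syz (k : fieldType) B d (w1 w2 : {poly k}) :
  primitive_syz B d w1 w2 -> syz B B B d w1 w2.
Proof.
case=> _ n1 n2 n3 o1 o3 s1 s2; split.
- by rewrite -mup0_geq // o1.
- by rewrite -mupN1_geq // o3.
- by rewrite s1.
- by nat_lia.
Qed.

Lemma primitive_syz_saturated (k : fieldType) B d a (w1 w2 : {poly k}) :
  primitive_syz B d w1 w2 -> saturated_syz a a a d w1 w2.
Proof.
case=> cop n1 n2 n3 o1 o3 s1 s2 g u v m E1 E2 [_ _ hu hv].
have g1 : size g = 1%N.
  by apply: (dvdp_coprime_size1 cop); rewrite ?E1 ?E2 dvdp_mulIl.
by have := s1; rewrite E1 size_mul1 //; nat_lia.
Qed.

(** The orders of [w1] at 0 and of [w1 + w2] at -1 are exactly [B], so a common factor [g] cannot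
    vanish at 0 or -1; it then divides the coprime [w1] and [w2]. The exact order at infinity gives
    the degree bound. *)
Lemma primitive_syz_mul_saturated (k : fieldType) B d s (w1 w2 : {poly k}) :
  primitive_syz B d w1 w2 ->
  saturated_syz (B + s) (B + s) (B + s) (d + 3 * s) ('X^s * ('X + 1) ^+ s * w1)
    ('X^s * ('X + 1) ^+ s * w2).
Proof.
case=> cop n1 n2 n3 o1 o3 s1 s2 g u v m E1 E2 [h1 h2 hu hv].
set T := 'X^s * ('X + 1) ^+ s in E1 E2.
have X0 : ('X^s : {poly k}) != 0 by rewrite expf_neq0 ?polyX_eq0.
have T0 : T != 0 by rewrite mulf_neq0 ?X1_exp_neq0.
have E3 : T * (w1 + w2) = g * (u + v) by rewrite !mulrDr E1 E2.
have g0 : g != 0 by apply: contraNneq (mulf_neq0 T0 n1) => z; rewrite E1 z mul0r.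
have u0 : u != 0 by apply: contraNneq (mulf_neq0 T0 n1) => z; rewrite E1 z mulr0.
have v0 : v != 0 by apply: contraNneq (mulf_neq0 T0 n2) => z; rewrite E2 z mulr0.
have uv0 : u + v != 0 by apply: contraNneq (mulf_neq0 T0 n3) => z; rewrite E3 z mulr0.
have mT0 : mup 0 T = s.
  rewrite /T mupMl; first by have := mup_XsubCX s (0 : k) 0; rewrite subr0 eqxx.
  by rewrite /root !hornerE expr1n oner_eq0.
have mT1 : mup (-1) T = s.
  rewrite /T mupMr; last by rewrite /root !hornerE expf_neq0 // oppr_eq0 oner_eq0.
  by have := mup_XsubCX s (-1 : k) (-1); rewrite polyCN opprK eqxx.
have gX : mup 0 g = 0%N.
  have : (s + B = mup 0 g + mup 0 u)%N by rewrite -mT0 -o1 -mupM // -mupM // E1.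
  by have := h1; rewrite -mup0_geq //; nat_lia.
have gX1 : mup (-1) g = 0%N.
  have : (s + B = mup (-1) g + mup (-1) (u + v))%N by rewrite -mT1 -o3 -mupM // -mupM // E3.
  by have := h2; rewrite -mupN1_geq //; nat_lia.
have cgT : coprimep g T.
  rewrite /T coprimepMr; apply/andP; split; apply: coprimep_expr.
    by rewrite coprimepX -dvdp_XsubCl XsubC_dvd // gX.
  have -> : 'X + 1 = 'X - (-1)%:P :> {poly k} by rewrite polyCN opprK.
  by rewrite coprimep_XsubC -dvdp_XsubCl XsubC_dvd // gX1.
have g1 : size g = 1%N.
  apply: (dvdp_coprime_size1 cop); first by rewrite -(Gauss_dvdpr _ cgT) E1 dvdp_mulIl.
  by rewrite -(Gauss_dvdpr _ cgT) E2 dvdp_mulIl.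
have : size ('X^s * ('X + 1) ^+ s * w2) = size v by rewrite -/T E2 size_mul1.
rewrite size_XX1_mul //.
by have := v0; rewrite -size_poly_gt0; nat_lia.
Qed.

(** A syzygy with exponents [J], pulled back along ['X^(p ^ e)] and moved to exponent [th] or
    [th + 1], has degree small enough for [syz_primitive]. The primitive relation so found, possibly
    with another [J] and power, is completed to a basis. *)
Lemma basis_pair_of_prime_power (k : fieldType) p e J th :
  p \in [pchar k] -> odd J ->
  (3 * (J * p ^ e) <= p ^ e + 1 + 3 * th)%N -> (3 * th + 2 <= 3 * (J * p ^ e) + p ^ e)%N ->
  basis_pair k th th.+1.
Proof.
move=> pk oJ h1 h2.
have [c [d [u [v [[cth cd] uv S]]]]] : exists c d (u v : {poly k}),
  [/\ (th <= c <= th.+1)%N /\ (2 * d + 2 <= 3 * c)%N, (u != 0) || (v != 0) & syz c c c d u v].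
  have [u0 [v0 [uv S0]]] := @exists_syz_diag k J (3 * J)./2 ltac:(nat_lia) ltac:(nat_lia).
  have S1 := syz_comp_Xq e pk S0.
  have q0 : (0 < p ^ e)%N by rewrite expn_gt0 prime_gt0 // (pcharf_prime pk).
  have hd : (2 * ((3 * J)./2 * p ^ e) + p ^ e = 3 * (J * p ^ e))%N.
    by rewrite !mulnA -mulSnr; congr (_ * _)%N; nat_lia.
  have uv1 : (u0 \Po 'X^(p ^ e) != 0) || (v0 \Po 'X^(p ^ e) != 0) by rewrite !comp_Xn_eq0.
  have [lt|ge] := ltnP th (J * p ^ e).
    exists th.+1, ((3 * J)./2 * p ^ e)%N, (u0 \Po 'X^(p ^ e)), (v0 \Po 'X^(p ^ e)); split=> //.
      by split; nat_lia.
    exact: syz_weaken S1.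
  pose t := (th - J * p ^ e)%N; have ht : (J * p ^ e + t = th)%N by rewrite subnKC.
  have := syz_mul_XYZ t S1; rewrite ht => S2.
  exists th, ((3 * J)./2 * p ^ e + 3 * t)%N,
    ('X^t * ('X + 1) ^+ t * (u0 \Po 'X^(p ^ e))), ('X^t * ('X + 1) ^+ t * (v0 \Po 'X^(p ^ e))).
  split=> //; first by split; nat_lia.
  by rewrite !mulf_eq0 !expf_eq0 polyX_eq0 -size_poly_eq0 -[1]/(1%:P) size_XaddC /= !andbF.
have [|p' [e' [J' [d' [w1 [w2 [pk' e0 oJ' [g1 g2] [hd' W]]]]]]]] := syz_primitive S uv cth cth cth.
  by nat_lia.
set B := (J' * p' ^ e')%N in g1 g2 hd' W *; set q := (p' ^ e')%N in g1 g2 hd'.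
have SW := primitive_syz_syz W; have nW := psyz_neq1 W.
have s2 := psyz_size2 W; have n2 := psyz_neq2 W; rewrite -size_poly_gt0 in n2.
(* If [B > th], the primitive relation is already divisible by the [(th + 1)]-st powers and serves
   as the first syzygy. *)
have [lt|ge] := ltnP th B.
  have ST := syz_weaken (ltnW lt) SW.
  have sat0 : saturated_syz th th th d' w1 w2 by exact: primitive_syz_saturated W.
  have [||x [y [l [l0 S' det]]]] := syz_complement ST _ sat0.
  - by rewrite nW.
  - by nat_lia.
  exists d', (th + th + th - d')%N, w1, w2, x, y, l; split=> //; last by nat_lia.
  exact: syz_weaken SW.
(* If [B <= th], the relation times [(X * Y * Z) ^ (t + 1)] is completed at exponent [th + 1]. The
   complement becomes the first syzygy, the relation times [(X * Y * Z) ^ t] the second one; this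
   removes one factor [X * Y * Z] from the determinant. *)
pose t := (th - B)%N; have ht : (B + t = th)%N by rewrite subnKC.
have ht1 : (B + t.+1 = th.+1)%N by rewrite addnS ht.
have := syz_mul_XYZ t.+1 SW; have := @primitive_syz_mul_saturated _ _ _ t.+1 _ _ W; rewrite ht1.
have X0 : ('X : {poly k}) * ('X + 1) != 0.
  by rewrite mulf_neq0 ?polyX_eq0 // -size_poly_eq0 -[1]/(1%:P) size_XaddC.
have T0 : 'X^(t.+1) * ('X + 1) ^+ t.+1 * w1 != 0.
  by rewrite mulf_neq0 // mulf_neq0 ?X1_exp_neq0 // expf_neq0 ?polyX_eq0.
move=> sat ST; have [||x [y [l [l0 S' det]]]] := syz_complement ST _ sat.
- by rewrite T0.
- by nat_lia.
have := syz_mul_XYZ t SW; rewrite ht => St.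
exists (th.+1 + th.+1 + th.+1 - (d' + 3 * t.+1))%N, (d' + 3 * t)%N, x, y,
  ('X^t * ('X + 1) ^+ t * w1), ('X^t * ('X + 1) ^+ t * w2), (- l); split=> //.
- by rewrite oppr_eq0.
- by nat_lia.
apply: (mulfI X0); rewrite scaleNr mulrN -scalerAr.
have -> : 'X * ('X + 1) * ('X^th * ('X + 1) ^+ th) = 'X^(th.+1) * ('X + 1) ^+ th.+1 :> {poly k}.
  by rewrite !exprS; ring.
by rewrite -det !exprS; ring.
Qed.

(** * Regular elements modulo the Fermat polynomial *)

(** Reduction modulo ['X_i], realized as an endomorphism so that the quotient is again inside a
    polynomial domain. *)
Definition kill_var (k : fieldType) n (i : 'I_n) : {mpoly k[n]} -> {mpoly k[n]} :=
  comp_mpoly [tuple (if j == i then 0 else 'X_j) | j < n].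

HB.instance Definition _ (k : fieldType) n (i : 'I_n) :=
  GRing.RMorphism.copy (@kill_var k n i)
    (comp_mpoly [tuple (if j == i then 0 else 'X_j) | j < n]).

Lemma kill_varP (k : fieldType) n (i : 'I_n) (p : {mpoly k[n]}) :
  exists g, p = kill_var i p + g * 'X_i.
Proof.
rewrite /kill_var; elim/mpolyind: p => [|c m p _ _ [g IH]].
  by exists 0; rewrite comp_mpoly0 mul0r addr0.
suff [h hX] : exists h, 'X_[m] = kill_var i 'X_[m] + h * 'X_i :> {mpoly k[n]}.
  exists (c *: h + g); rewrite comp_mpolyD comp_mpolyZ mulrDl [in LHS]IH -scalerAl.
  by rewrite [in LHS]hX scalerDr addrACA.
have [mi0|mi0] := eqVneq (m i) 0%N.
  exists 0; rewrite mul0r addr0 /kill_var comp_mpolyX [LHS]mpolyXE_id.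
  by apply: eq_bigr => j _; rewrite tnth_mktuple; case: eqP => // ->; rewrite mi0 !expr0.
exists 'X_[m - U_(i)]; rewrite -mpolyXD submK ?lep1mP // /kill_var comp_mpolyX.
by rewrite (bigD1 i) //= tnth_mktuple eqxx expr0n (negPf mi0) mul0r add0r.
Qed.

Lemma kill_varD (k : fieldType) n (i : 'I_n) : {morph @kill_var k n i : p q / p + q}.
Proof. exact: rmorphD. Qed.

Lemma kill_varM (k : fieldType) n (i : 'I_n) : {morph @kill_var k n i : p q / p * q}.
Proof. exact: rmorphM. Qed.

Lemma kill_varXn (k : fieldType) n (i : 'I_n) m : {morph @kill_var k n i : p / p ^+ m}.
Proof. exact: rmorphXn. Qed.

Definition kill_varE := (kill_varD, kill_varM, kill_varXn).

Lemma kill_varX (k : fieldType) n (i j : 'I_n) :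
  kill_var i ('X_j : {mpoly k[n]}) = if j == i then 0 else 'X_j.
Proof. by rewrite /kill_var comp_mpolyXU -tnth_nth tnth_mktuple. Qed.

Lemma kill_var_eq0 (k : fieldType) n (i : 'I_n) (p : {mpoly k[n]}) :
  kill_var i p = 0 -> exists g, p = g * 'X_i.
Proof. by move=> p0; have [g] := kill_varP i p; rewrite p0 add0r; exists g. Qed.

Notation ox := (@Ordinal 3 0 isT).
Notation oy := (@Ordinal 3 1 isT).
Notation oz := (@Ordinal 3 2 isT).

Definition fermat (k : fieldType) n : {mpoly k[3]} := vx k ^+ n + vy k ^+ n + vz k ^+ n.

Lemma mevalXn (k : fieldType) n (v : 'I_n -> k) m : {morph meval v : p / p ^+ m}.
Proof. exact: rmorphXn. Qed.

Lemma mpoly_neq0 (k : fieldType) n (v : 'I_n -> k) (p : {mpoly k[n]}) : p.@[v] != 0 -> p != 0.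
Proof. by apply: contraNneq => ->; rewrite meval0. Qed.

Lemma kill_var_fermat_neq0 (k : fieldType) n (i : 'I_3) : (0 < n)%N ->
  kill_var i (fermat k n) != 0.
Proof.
case: n => // n _.
pose v (j : 'I_3) : k := (j == if i == ox then oy else ox)%:R.
apply: (@mpoly_neq0 _ _ v); rewrite /fermat !kill_varE !kill_varX !mevalD !mevalXn.
case: i @v => -[|[|[|//]]] lti v; rewrite -!val_eqE /= ?meval0 ?mevalXU /v /= -?val_eqE /= ?expr1n;
  by rewrite ?expr0n /= ?addr0 ?add0r oner_eq0.
Qed.

Lemma fermat_neq0 (k : fieldType) n : (0 < n)%N -> fermat k n != 0.
Proof.
move=> n0; apply: contraNneq (kill_var_fermat_neq0 k ox n0) => ->.
by rewrite /kill_var comp_mpoly0.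
Qed.

Lemma mpolyX_neq0 (k : fieldType) n (i : 'I_n) : 'X_i != 0 :> {mpoly k[n]}.
Proof. by apply: (@mpoly_neq0 _ _ (fun=> 1)); rewrite mevalXU oner_eq0. Qed.

(** Modulo ['X_i] the Fermat polynomial is a nonzero element of a domain, so ['X_i] divides [g]. *)
Lemma var_regular_mod_fermat (k : fieldType) n (i : 'I_3) (a g : {mpoly k[3]}) : (0 < n)%N ->
  'X_i * a = g * fermat k n -> exists h, a = h * fermat k n.
Proof.
move=> n0 e; have [h eg] : exists h, g = h * 'X_i.
  apply: kill_var_eq0; apply/eqP.
  have := congr1 (kill_var i) e; rewrite 2!kill_varM kill_varX eqxx mul0r => /esym/eqP.
  by rewrite mulf_eq0 (negPf (kill_var_fermat_neq0 _ _ n0)) orbF.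
by exists h; apply: (mulfI (mpolyX_neq0 k i)); rewrite e eg; ring.
Qed.

(** At [z = 0] the factor next to [h] becomes a power of [y], so factors [z] can be split off [h]
    one by one. *)
Lemma vz_exp_Gauss (k : fieldType) n N (h c : {mpoly k[3]}) :
  h * (vy k ^+ n.+1 + vz k ^+ n.+1) = vz k ^+ N * c -> exists h', h = vz k ^+ N * h'.
Proof.
elim: N h => [|N IH] h e; first by exists h; rewrite expr0 mul1r.
have [h1 e1] : exists h1, h = h1 * vz k.
  apply: kill_var_eq0; apply/eqP; have := congr1 (kill_var oz) e.
  rewrite !kill_varE !kill_varX eqxx !expr0n /= mul0r addr0 => /eqP.
  by rewrite mulf_eq0 expf_eq0 (negPf (mpolyX_neq0 _ _)) andbF orbF.
have [|h' e'] := IH h1; last by exists h'; rewrite e1 e' exprS; ring.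
by apply: (mulfI (mpolyX_neq0 k oz)); rewrite -/(vz k) (mulrA _ h1) [_ * h1]mulrC -e1 e exprS mulrA.
Qed.

(** One factor [x] is cancelled at a time. Modulo [x], [vz_exp_Gauss] makes the reductions of [g]
    and [b] the multiples of a common [g3] by [z ^ N] and by [-(y ^ n + z ^ n)]; their contributions
    then cancel up to a multiple of [x ^ n]. *)
Lemma vx_vz_regular (k : fieldType) n N s (a b g : {mpoly k[3]}) : (0 < n)%N ->
  vx k ^+ s * a = vz k ^+ N * b + g * fermat k n ->
  exists a' g', a = vz k ^+ N * a' + g' * fermat k n.
Proof.
case: n => // n _; elim: s a b g => [|s IH] a b g e.
  by exists b, g; rewrite -e expr0 mul1r.
suff [a' [g' e']] : exists a' g', vx k ^+ s * a = vz k ^+ N * a' + g' * fermat k n.+1.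
  exact: IH e'.
have [b2 eb] := kill_varP ox b; have [g2 eg] := kill_varP ox g.
set b1 := kill_var _ _ in eb; set g1 := kill_var _ _ in eg.
have := congr1 (kill_var ox) e.
rewrite !kill_varE !kill_varX eqxx !expr0n /= !mul0r add0r -/b1 -/g1.
rewrite -/(vy k) -/(vz k) => e0.
have [g3 eg3] : exists g3, g1 = vz k ^+ N * g3.
  by apply: (@vz_exp_Gauss _ n _ _ (- b1)); apply/eqP; rewrite -subr_eq0 e0; apply/eqP; ring.
have eb3 : b1 = - g3 * (vy k ^+ n.+1 + vz k ^+ n.+1).
  apply: (mulfI (expf_neq0 N (mpolyX_neq0 k oz))); rewrite -/(vz k).
  by apply/eqP; rewrite -subr_eq0 e0 eg3; apply/eqP; ring.
exists (b2 + g3 * vx k ^+ n), g2; apply: (mulfI (mpolyX_neq0 k ox)).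
rewrite -/(vx k) [LHS]mulrA -exprS e eb eg eb3 eg3 /fermat -/(vx k) !exprS; ring.
Qed.

(** * Hilbert-Burch resolutions *)

Lemma projective_rV (R : comNzRingType) n : projective_mod 'rV[R]_n.
Proof.
move=> A B f g f_surj.
have [a ha] : exists a : 'I_n -> A, forall j, f (a j) = g (delta_mx 0 j).
  by apply: (fin_all_exists (P := fun j x => f x = g (delta_mx 0 j))) => j; apply: f_surj.
pose h (v : 'rV[R]_n) := \sum_j v 0 j *: a j.
have hlin : linear h.
  move=> r u v; rewrite /h scaler_sumr -big_split /=; apply: eq_bigr => j _.
  by rewrite !mxE scalerDl scalerA.
pose H : {linear 'rV[R]_n -> A} := HB.pack h (GRing.isLinear.Build _ _ _ _ h hlin).
exists H => v; rewrite /=.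
rewrite /h linear_sum [in RHS](row_sum_delta v) linear_sum; apply: eq_bigr => j _.
by rewrite !linearZ /= ha.
Qed.

(** The resolution has ranks 1, 3, 2. One minor equal to a unit times [s] suffices: with [s] regular
    and [p] regular modulo [s], Cramer's rule solves for every syzygy. *)
Lemma finite_pd_hilbert_burch (R : comNzRingType) (M : lmodType R) (pi : {linear R^o -> M})
    (p q s u1 u2 u3 v1 v2 v3 ka ka' : R) :
  (forall m, exists r, pi r = m) ->
  (forall r, pi r = 0 <-> exists a b c, r = a * p + b * q + c * s) ->
  u1 * p + u2 * q + u3 * s = 0 -> v1 * p + v2 * q + v3 * s = 0 ->
  u1 * v2 - u2 * v1 = ka * s -> ka' * ka = 1 ->
  (forall a, s * a = 0 -> a = 0) ->
  (forall a b, p * a = s * b -> exists c, a = s * c) ->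
  finite_pd M.
Proof.
move=> pi_surj pi_ker relu relv minor kaK reg_s reg_ps.
have cancel a : ka * s * a = 0 -> a = 0.
  by move=> h; apply: reg_s; rewrite -[s]mul1r -kaK -!mulrA [ka * _]mulrA h mulr0.
have cramer a b c : a * p + b * q + c * s = 0 -> exists al be,
    [/\ a = al * u1 + be * v1, b = al * u2 + be * v2 & c = al * u3 + be * v3].
  move=> rel.
  (* Eliminating [q] from the two relations shows that [p] times this minor is a multiple of [s];
     regularity of [p] modulo [s] divides it. *)
  have [al hal] : exists al, a * v2 - b * v1 = s * al.
    apply: (reg_ps _ (b * v3 - c * v2)).
    transitivity (v2 * (a * p + b * q + c * s) - b * (v1 * p + v2 * q + v3 * s)
                  + s * (b * v3 - c * v2)); first by ring.
    by rewrite rel relv; ring.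
  have [be hbe] : exists be, u1 * b - u2 * a = s * be.
    apply: (reg_ps _ (c * u2 - b * u3)).
    transitivity (b * (u1 * p + u2 * q + u3 * s) - u2 * (a * p + b * q + c * s)
                  + s * (c * u2 - b * u3)); first by ring.
    by rewrite rel relu; ring.
  have reg x y : s * x = s * y -> x = y.
    by move=> e; apply/eqP; rewrite -subr_eq0; apply/eqP/reg_s; rewrite mulrBr e subrr.
  have ea : ka * a = al * u1 + be * v1.
    apply: reg; transitivity (a * (ka * s)); first by ring.
    rewrite -minor; transitivity (u1 * (s * al) + v1 * (s * be)); last by ring.
    by rewrite -hal -hbe; ring.
  have eb : ka * b = al * u2 + be * v2.
    apply: reg; transitivity (b * (ka * s)); first by ring.
    rewrite -minor; transitivity (u2 * (s * al) + v2 * (s * be)); last by ring.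
    by rewrite -hal -hbe; ring.
  have ec : ka * c = al * u3 + be * v3.
    apply: reg; transitivity (ka * (a * p + b * q + c * s) - ka * a * p - ka * b * q); first by ring.
    rewrite rel ea eb; transitivity (s * (al * u3 + be * v3)
      - al * (u1 * p + u2 * q + u3 * s) - be * (v1 * p + v2 * q + v3 * s)); first by ring.
    by rewrite relu relv; ring.
  exists (ka' * al), (ka' * be); split.
  - by rewrite -[LHS]mul1r -kaK -mulrA ea; ring.
  - by rewrite -[LHS]mul1r -kaK -mulrA eb; ring.
  - by rewrite -[LHS]mul1r -kaK -mulrA ec; ring.
have indep al be : al * u1 + be * v1 = 0 -> al * u2 + be * v2 = 0 -> al = 0 /\ be = 0.
  move=> h1 h2; split; apply: cancel; rewrite -minor.
    transitivity (v2 * (al * u1 + be * v1) - v1 * (al * u2 + be * v2)); first by ring.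
    by rewrite h1 h2; ring.
  transitivity (u1 * (al * u2 + be * v2) - u2 * (al * u1 + be * v1)); first by ring.
  by rewrite h1 h2; ring.
(* The default of [nth] makes all further modules zero. *)
pose rk i := nth 0%N [:: 1; 3; 2]%N i.
pose M0 : 'M[R]_(3, 1) := \matrix_(i, j) [:: p; q; s]`_i.
pose M1 : 'M[R]_(2, 3) := \matrix_(i, j) nth 0 (nth [::] [:: [:: u1; u2; u3]; [:: v1; v2; v3]] i) j.
pose D i : 'M[R]_(rk i.+1, rk i) :=
  match i return 'M[R]_(rk i.+1, rk i) with O => M0 | S O => M1 | _ => 0 end.
pose d i : {linear 'rV[R]_(rk i.+1) -> 'rV[R]_(rk i)} := mulmxr (D i).
have elin : linear (fun x : 'rV[R]_(rk 0%N) => pi (x 0 0)).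
  by move=> r x y; rewrite !mxE linearP.
pose e : {linear 'rV[R]_(rk 0%N) -> M} :=
  HB.pack (fun x : 'rV[R]_(rk 0%N) => pi (x 0 0)) (GRing.isLinear.Build _ _ _ _ _ elin).
have d0E (y : 'rV[R]_3) : (y *m M0) 0 0 = y 0 0 * p + y 0 1 * q + y 0 2 * s.
  rewrite mxE !big_ord_recl big_ord0 addr0 !mxE /= addrA.
  by congr (_ + _ + _); congr (y 0 _ * _); apply: val_inj.
have d1E (y : 'rV[R]_2) j : (y *m M1) 0 j = y 0 0 * M1 0 j + y 0 1 * M1 1 j.
  rewrite mxE !big_ord_recl big_ord0 addr0.
  by congr (_ + _); congr (y 0 _ * M1 _ _); apply: val_inj.
exists 2%N, (fun i => 'rV[R]_(rk i)), d, e; split.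
- move=> y; have [r <-] := pi_surj y; exists (const_mx r); by rewrite /= mxE.
- move=> x; rewrite /= pi_ker; split=> [[a [b [c xE]]]|[y <-]].
    exists (\row_j [:: a; b; c]`_j : 'rV_3).
    by apply/rowP => j; rewrite ord1 [LHS]d0E !mxE /= xE.
  by exists (y 0 0), (y 0 1), (y 0 2); rewrite d0E.
- have M1E : (forall j, M1 0 j = [:: u1; u2; u3]`_j) * (forall j, M1 1 j = [:: v1; v2; v3]`_j).
    by split=> j; rewrite mxE.
  case=> [|[|i]] x; rewrite [d _ _]/(_ *m _).
  + split=> [xM0|[y <-]]; last first.
      apply/rowP => j; rewrite ord1 [LHS]d0E !d1E !M1E mxE /=.
      transitivity (y 0 0 * (u1 * p + u2 * q + u3 * s) + y 0 1 * (v1 * p + v2 * q + v3 * s)); first by ring.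
      by rewrite relu relv !mulr0 addr0.
    have rel : x 0 0 * p + x 0 1 * q + x 0 2 * s = 0.
      by have /rowP/(_ 0) := xM0; rewrite [LHS]d0E mxE.
    have [al [be [e1 e2 e3]]] := cramer _ _ _ rel.
    exists (\row_j [:: al; be]`_j : 'rV_2); apply/rowP => j.
    rewrite [LHS]d1E !M1E !mxE /=; case: j => -[|[|[|//]]] ltj /=.
    * by rewrite -e1; congr (x 0 _); apply: val_inj.
    * by rewrite -e2; congr (x 0 _); apply: val_inj.
    * by rewrite -e3; congr (x 0 _); apply: val_inj.
  + split=> [xM1|[y <-]]; last by (have -> : d 2%N y = 0 by exact: mulmx0); exact: mul0mx.
    have xj j : x 0 0 * M1 0 j + x 0 1 * M1 1 j = 0.
      by have /rowP/(_ j) := xM1; rewrite [LHS]d1E => ->; apply: mxE.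
    have [x0 x1] : x 0 0 = 0 /\ x 0 1 = 0.
      by apply: indep; [have := xj 0 | have := xj 1]; rewrite !M1E.
    exists 0; rewrite linear0; apply/rowP => -[[|[|//]] ltj]; rewrite mxE.
      by rewrite -x0; congr (x 0 _); apply: val_inj.
    by rewrite -x1; congr (x 0 _); apply: val_inj.
  + split=> [_|[y <-]]; last by exact: mulmx0.
    by exists 0; apply/rowP => -[j ltj]; exfalso; move: ltj; rewrite /rk /= nth_nil.
- by move=> i; apply: projective_rV.
- by case=> [|[|[|i]]] // _ x; apply/rowP => -[j ltj]; exfalso; move: ltj; rewrite /rk /= nth_nil.
Qed.

(** * Lifting syzygies to the Fermat ring *)

Definition homogenize (k : fieldType) (R : comNzRingType) (al : {rmorphism k -> R}) (X Y : R)
    d (p : {poly k}) : R :=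
  \sum_(i < d.+1) al p`_i * X ^+ i * Y ^+ (d - i).

Lemma homogenizeD (k : fieldType) (R : comNzRingType) (al : {rmorphism k -> R}) (X Y : R) d :
  {morph homogenize al X Y d : p q / p + q}.
Proof.
move=> p q; rewrite /homogenize -big_split /=; apply: eq_bigr => i _.
by rewrite coefD rmorphD !mulrDl.
Qed.

Lemma homogenizeZ (k : fieldType) (R : comNzRingType) (al : {rmorphism k -> R}) (X Y : R) d c p :
  homogenize al X Y d (c *: p) = al c * homogenize al X Y d p.
Proof.
rewrite /homogenize mulr_sumr; apply: eq_bigr => i _.
by rewrite coefZ rmorphM !mulrA.
Qed.

Lemma homogenize0 (k : fieldType) (R : comNzRingType) (al : {rmorphism k -> R}) (X Y : R) d :
  homogenize al X Y d 0 = 0.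
Proof. by rewrite -[0 in LHS](scale0r 0) homogenizeZ rmorph0 mul0r. Qed.

Lemma homogenize_sum (k : fieldType) (R : comNzRingType) (al : {rmorphism k -> R}) (X Y : R) d
    m (F : 'I_m -> {poly k}) :
  homogenize al X Y d (\sum_i F i) = \sum_i homogenize al X Y d (F i).
Proof. by apply: (big_morph _ (homogenizeD al X Y d) (homogenize0 al X Y d)). Qed.

Lemma homogenizeXn (k : fieldType) (R : comNzRingType) (al : {rmorphism k -> R}) (X Y : R) d i :
  (i <= d)%N -> homogenize al X Y d 'X^i = X ^+ i * Y ^+ (d - i).
Proof.
rewrite -ltnS => lti; rewrite /homogenize (bigD1 (Ordinal lti)) //= coefXn eqxx rmorph1 mul1r.
rewrite big1 ?addr0 // => j /negPf; rewrite -val_eqE /= coefXn => ->.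
by rewrite rmorph0 !mul0r.
Qed.

Lemma homogenizeM (k : fieldType) (R : comNzRingType) (al : {rmorphism k -> R}) (X Y : R) d e
    (p q : {poly k}) :
  (size p <= d.+1)%N -> (size q <= e.+1)%N ->
  homogenize al X Y (d + e) (p * q) = homogenize al X Y d p * homogenize al X Y e q.
Proof.
move=> sp sq.
have polyE m (r : {poly k}) : (size r <= m)%N -> r = \sum_(i < m) r`_i *: 'X^i.
  move=> sr; rewrite -poly_def; apply/polyP => i; rewrite coef_poly.
  by case: ltnP => // /(leq_trans sr) h; rewrite nth_default.
rewrite {1}(polyE _ _ sp) {1}(polyE _ _ sq) mulr_suml homogenize_sum {2}/homogenize mulr_suml.
apply: eq_bigr => i _; rewrite mulr_sumr homogenize_sum mulr_sumr; apply: eq_bigr => j _.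
rewrite -scalerAl -scalerAr scalerA homogenizeZ -exprD rmorphM homogenizeXn; last first.
  by rewrite leq_add // -ltnS.
have -> : (d + e - (i + j) = (d - i) + (e - j))%N.
  by have := ltn_ord i; have := ltn_ord j; lia.
by rewrite !exprD; ring.
Qed.

Lemma homogenizeX1n (k : fieldType) (R : comNzRingType) (al : {rmorphism k -> R}) (X Y : R) c :
  homogenize al X Y c (('X + 1) ^+ c) = (X + Y) ^+ c.
Proof.
elim: c => [|c IH]; first by rewrite expr0 -[1]/('X^0) homogenizeXn // !expr0 mulr1.
have sX1 : (size ('X + 1 : {poly k})%R <= 2)%N by rewrite -[_ + _]expr1 size_X1_exp.
rewrite !exprS -add1n homogenizeM ?IH ?size_X1_exp //.
congr (_ * _); rewrite homogenizeD -['X in LHS]expr1 -[1]/('X^0) !homogenizeXn //.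
by rewrite expr1 expr0 mulr1 mul1r.
Qed.

(** The order at infinity, encoded in the size of [v], is what lets [Y ^+ b] split off. *)
Lemma homogenize_syz (k : fieldType) (R : comNzRingType) (al : {rmorphism k -> R}) (X Y : R)
    a b c d (u v : {poly k}) : syz a b c d u v ->
  exists A B C, [/\ homogenize al X Y d u = X ^+ a * A, homogenize al X Y d v = Y ^+ b * B
    & homogenize al X Y d u + homogenize al X Y d v = (X + Y) ^+ c * C].
Proof.
case=> /dvdpP[p Ep] /dvdpP[q Eq] hu hv.
have [A hA] : exists A, homogenize al X Y d u = X ^+ a * A.
  have [p0|p0] := eqVneq p 0; first by exists 0; rewrite Ep p0 mul0r homogenize0 mulr0.
  have sp : (0 < size p)%N by rewrite size_poly_gt0.
  have szu : size u = (a + size p)%N by rewrite Ep size_mulXn.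
  have ad : (a <= d)%N by nat_lia.
  exists (homogenize al X Y (d - a) p); rewrite -{1}(subnKC ad) Ep mulrC homogenizeM ?size_polyXn //.
    by rewrite homogenizeXn // subnn mulr1.
  by nat_lia.
have [B hB] : exists B, homogenize al X Y d v = Y ^+ b * B.
  have [v0|v0] := eqVneq v 0; first by exists 0; rewrite v0 homogenize0 mulr0.
  have sv : (0 < size v)%N by rewrite size_poly_gt0.
  have bd : (b <= d)%N by nat_lia.
  exists (homogenize al X Y (d - b) v); rewrite -{1}(subnKC bd) -{1}[v]mul1r homogenizeM ?size_poly1 //.
    by rewrite -[1]/('X^0) homogenizeXn // subn0 mul1r.
  by nat_lia.
have [C hC] : exists C, homogenize al X Y d (u + v) = (X + Y) ^+ c * C.
  have [q0|q0] := eqVneq q 0; first by exists 0; rewrite Eq q0 mul0r homogenize0 mulr0.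
  have sq : (0 < size q)%N by rewrite size_poly_gt0.
  have szw : size (u + v) = (c + size q)%N.
    by rewrite Eq size_mul ?X1_exp_neq0 // size_X1_exp; nat_lia.
  have suv : (size (u + v)%R <= d.+1)%N.
    by rewrite (leq_trans (size_polyD _ _)) // geq_max hu; nat_lia.
  have cd : (c <= d)%N by nat_lia.
  exists (homogenize al X Y (d - c) q); rewrite -{1}(subnKC cd) Eq mulrC homogenizeM ?size_X1_exp //.
    by rewrite homogenizeX1n.
  by nat_lia.
by exists A, B, C; rewrite -homogenizeD.
Qed.

Lemma presents_var_regular (k : fieldType) n (R : comNzRingType)
    (phi : {rmorphism {mpoly k[3]} -> R}) (i : 'I_3) m (a : R) :
  (0 < n)%N -> presents_Rkn n phi -> phi 'X_i ^+ m * a = 0 -> a = 0.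
Proof.
move=> n0 [phi_surj phi_ker]; elim: m a => [|m IH] a; first by rewrite expr0 mul1r.
rewrite exprSr -mulrA => /IH; have [A <-] := phi_surj a.
rewrite -rmorphM => /phi_ker[g /(var_regular_mod_fermat n0)[h eA]].
by apply/phi_ker; exists h.
Qed.

Lemma presents_xz_regular (k : fieldType) n (R : comNzRingType)
    (phi : {rmorphism {mpoly k[3]} -> R}) N (a b : R) :
  (0 < n)%N -> presents_Rkn n phi -> phi (vx k) ^+ N * a = phi (vz k) ^+ N * b ->
  exists c, a = phi (vz k) ^+ N * c.
Proof.
move=> n0 [phi_surj phi_ker]; have [A <-] := phi_surj a; have [B <-] := phi_surj b.
rewrite -!rmorphXn -!rmorphM => /eqP; rewrite -subr_eq0 -rmorphB => /eqP/phi_ker[g e].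
have [A' [g' eA]] : exists A' g', A = vz k ^+ N * A' + g' * fermat k n.
  by apply: (vx_vz_regular (b := B) (g := g) (s := N) n0); rewrite /fermat -e addrC subrK.
exists (phi A'); rewrite eA rmorphD rmorphM -[RHS]addr0; congr (_ + _).
by apply/phi_ker; exists g'.
Qed.

(** With [X = x ^ n] and so on, the first syzygy has exponents [n * rho >= N] and its excess goes
    into the coefficients; the second has exponents [n * th <= N] and is multiplied by
    [(x * y * z) ^ r]. Signs come from [x ^ n + y ^ n = - z ^ n]. *)
Lemma finite_pd_of_basis_pair (k : fieldType) (n N th rho r : nat) (R : comNzRingType)
    (phi : {rmorphism {mpoly k[3]} -> R}) (M : lmodType R) (pi : {linear R^o -> M}) :
  (0 < n)%N -> presents_Rkn n phi -> presents_Q N phi pi ->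
  N = (n * th + r)%N -> (N <= n * rho)%N -> basis_pair k th rho -> finite_pd M.
Proof.
move=> n0 presR [pi_surj pi_ker] hN hrho [d [e [u1 [u2 [v1 [v2 [l [l0 Su Sv de det]]]]]]]].
pose al : {rmorphism k -> R} := phi \o @mpolyC 3 k.
pose x := phi (vx k); pose y := phi (vy k); pose z := phi (vz k).
have fer : x ^+ n + y ^+ n = - z ^+ n.
  apply/eqP; rewrite -subr_eq0 opprK -!rmorphXn -!rmorphD; apply/eqP/presR.2.
  by exists 1; rewrite mul1r.
have [A [B [C [hA hB hC]]]] := homogenize_syz al (x ^+ n) (y ^+ n) Su.
have [A' [B' [C' [hA' hB' hC']]]] := homogenize_syz al (x ^+ n) (y ^+ n) Sv.
have [Su1 Su2] : (size u1 <= d.+1)%N /\ (size u2 <= d.+1)%N by case: Su => _ _ h1 h2; split; nat_lia.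
have [Sv1 Sv2] : (size v1 <= e.+1)%N /\ (size v2 <= e.+1)%N by case: Sv => _ _ h1 h2; split; nat_lia.
have hdet : homogenize al (x ^+ n) (y ^+ n) (3 * th) (u1 * v2 - u2 * v1) =
    al l * (-1) ^+ th * (x * y * z) ^+ (n * th).
  rewrite det homogenizeZ -mulrA; congr (_ * _).
  have -> : (3 * th = th + th + th)%N by lia.
  rewrite -['X^th * _]mulr1 !homogenizeM ?size_X1_exp ?size_polyXn ?size_poly1 //; last first.
    rewrite size_mul ?X1_exp_neq0 // -?size_poly_eq0 ?size_polyXn // size_X1_exp; lia.
  rewrite homogenizeX1n homogenizeXn // -[1 : {poly k}]/('X^0) homogenizeXn // fer (exprNn (z ^+ n)).
  by rewrite subnn subn0 !expr0 !exprMn !exprM; ring.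
rewrite -de -scaleN1r scalerAl homogenizeD !homogenizeM ?size_scale ?oppr_eq0 ?oner_eq0 // in hdet.
rewrite homogenizeZ rmorphN rmorph1 mulN1r hA hB hA' hB' in hdet.
have rel : x ^+ n ^+ rho * A + y ^+ n ^+ rho * B = (-1) ^+ rho * z ^+ n ^+ rho * C.
  by rewrite -hA -hB hC fer (exprNn (z ^+ n)).
have rel' : x ^+ n ^+ th * A' + y ^+ n ^+ th * B' = (-1) ^+ th * z ^+ n ^+ th * C'.
  by rewrite -hA' -hB' hC' fer (exprNn (z ^+ n)).
pose s := (n * rho - N)%N; have hs : (n * rho = N + s)%N by rewrite subnKC.
rewrite -!exprM hs !exprD in rel; rewrite -!exprM in rel'.
rewrite -!exprM hs !exprD in hdet.
have vE (w : R) : w ^+ N = w ^+ (n * th) * w ^+ r by rewrite hN exprD.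
apply: (@finite_pd_hilbert_burch R M pi (x ^+ N) (y ^+ N) (z ^+ N)
  (x ^+ s * A) (y ^+ s * B) (- (-1) ^+ rho * z ^+ s * C)
  ((y * z) ^+ r * A') ((x * z) ^+ r * B') (- (-1) ^+ th * (x * y) ^+ r * C')
  (al l * (-1) ^+ th) ((-1) ^+ th * al l^-1)) => //.
- by move=> w; rewrite pi_ker !rmorphXn.
- by apply/eqP; rewrite -subr_eq0; apply/eqP; rewrite -[RHS](subrr ((-1) ^+ rho * (z ^+ N * z ^+ s) * C)) -{1}rel; ring.
- rewrite !vE; transitivity ((x * y * z) ^+ r * (x ^+ (n * th) * A' + y ^+ (n * th) * B'
     - (-1) ^+ th * z ^+ (n * th) * C')); first by rewrite !exprMn; ring.
  by rewrite rel' subrr mulr0.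
(* The minor is compared after multiplication by the regular element [x ^ N * y ^ N], where it
   becomes [(x * y * z) ^ r] times the homogenized determinant. *)
- have reg i (a b : R) : phi 'X_i ^+ N * a = phi 'X_i ^+ N * b -> a = b.
    move=> h; apply/eqP; rewrite -subr_eq0; apply/eqP.
    by apply: (presents_var_regular (m := N) (i := i) n0 presR); rewrite mulrBr h subrr.
  apply: (reg ox); apply: (reg oy); rewrite -/(vx k) -/(vy k) -/x -/y.
  transitivity ((x * y * z) ^+ r * (al l * (-1) ^+ th * (x * y * z) ^+ (n * th))).
    by rewrite -hdet !vE !exprMn; ring.
  by rewrite !vE !exprMn; ring.
- transitivity (((-1) ^+ th * (-1) ^+ th) * (al l^-1 * al l)); first by ring.
  by rewrite -exprMn mulrNN mulr1 expr1n mul1r -rmorphM mulVf // rmorph1.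
- by move=> a; apply: (presents_var_regular (i := oz) n0 presR).
- by move=> a b; apply: (presents_xz_regular n0 presR).
Qed.

(** * The Koszul matrix factorization *)

(** The Koszul matrix factorization of [a true * a false + b true * b false + c true * c false]. The
    three bits index the monomials of an exterior algebra, both parities together; the signs make
    the three parts anticommute. *)
Definition koszul (R : comNzRingType) (a b c : bool -> R) (V : lmodType R)
    (w : bool -> bool -> bool -> V) (i j l : bool) : V :=
  a i *: w (~~ i) j l + ((-1) ^+ i * b j) *: w i (~~ j) l
  + ((-1) ^+ (i + j)%N * c l) *: w i j (~~ l).

Lemma koszul_sq (R : comNzRingType) (a b c : bool -> R) (V : lmodType R) w i j l :
  koszul a b c (@koszul R a b c V w) i j l =
  (a true * a false + b true * b false + c true * c false) *: w i j l.
Proof.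
have sum9 (x1 x2 x3 y1 y2 y3 z1 z2 z3 : V) : x2 + y1 = 0 -> x3 + z1 = 0 -> y3 + z2 = 0 ->
    x1 + x2 + x3 + (y1 + y2 + y3) + (z1 + z2 + z3) = x1 + y2 + z3.
  move=> h1 h2 h3; rewrite [LHS](AC (3*3*3) ((1*5*9)*((2*4)*(3*7)*(6*8)))) /=.
  by rewrite h1 h2 h3 !addr0.
rewrite /koszul !scalerDr !scalerA !negbK sum9 -?scalerDl.
- congr (_ *: _); case: i; case: j; case: l => /=; ring.
- by rewrite -[RHS](scale0r (w (~~ i) (~~ j) l)); congr (_ *: _); case: i; case: j => /=; ring.
- by rewrite -[RHS](scale0r (w (~~ i) j (~~ l))); congr (_ *: _); case: i; case: j; case: l => /=; ring.
- by rewrite -[RHS](scale0r (w i (~~ j) (~~ l))); congr (_ *: _); case: i; case: j; case: l => /=; ring.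
Qed.

Lemma koszul_linear (R : comNzRingType) (a b c : bool -> R) (V W : lmodType R)
    (f : {linear V -> W}) w i j l :
  f (koszul a b c w i j l) = koszul a b c (fun i j l => f (w i j l)) i j l.
Proof. by rewrite /koszul !linearD !linearZ. Qed.

Lemma koszulB (R : comNzRingType) (a b c : bool -> R) (V : lmodType R)
    (w w' : bool -> bool -> bool -> V) i j l :
  koszul a b c (fun i j l => w i j l - w' i j l) i j l =
  koszul a b c w i j l - koszul a b c w' i j l.
Proof. by rewrite /koszul !scalerBr !opprD [LHS](AC (2*2*2) ((1*3*5)*(2*4*6))). Qed.

Definition koszul_exact (R : comNzRingType) (a b c : bool -> R) (V : lmodType R) : Prop :=
  forall w : bool -> bool -> bool -> V, (forall i j l, koszul a b c w i j l = 0) ->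
  exists v, forall i j l, w i j l = koszul a b c v i j l.

Lemma bool3_choice (V : Type) (P : bool -> bool -> bool -> V -> Prop) :
  (forall i j l, exists x, P i j l x) -> exists f, forall i j l, P i j l (f i j l).
Proof.
have bool_choice T (Q : bool -> T -> Prop) :
    (forall b, exists x, Q b x) -> exists f, forall b, Q b (f b).
  move=> h; have [x hx] := h true; have [y hy] := h false.
  by exists (fun b => if b then x else y) => -[].
move=> h; apply: (bool_choice _ (fun i f => forall j l, P i j l (f j l))) => i.
by apply: (bool_choice _ (fun j f => forall l, P i j l (f l))) => j; apply: bool_choice.
Qed.

Lemma fglift_linear (R : comNzRingType) (K : choiceType) (V : lmodType R) (f : K -> V) :
  linear (fglift f : {freeg K / R} -> V).
Proof.
pose F : {additive {freeg K / R} -> V} :=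
  HB.pack (fglift f) (GRing.isZmodMorphism.Build _ _ (fglift f) (lift_is_additive f)).
move=> r D D'; rewrite -[fglift f]/(F : _ -> _) raddfD; congr (_ + _).
have -> : r *: D = \sum_(x <- dom D) << r * coeff x D *g x >> by [].
rewrite -[in RHS](freeg_sumE D) (raddf_sum F) [in RHS](raddf_sum F) scaler_sumr.
by apply: eq_bigr => x _; rewrite /= !liftU scalerA.
Qed.

(** Exactness is checked coordinatewise; only the finitely many coordinates in the supports of [w]
    need a preimage. *)
Lemma koszul_exact_freeg (R : comNzRingType) (a b c : bool -> R) (K : choiceType) :
  koszul_exact a b c R^o -> koszul_exact a b c {freeg K / R}.
Proof.
move=> exR w Dw0.
have coeff_lin x : linear (coeff x : {freeg K / R} -> R^o).
  by move=> r D D'; rewrite coeffD coeffZ.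
pose co x : {linear {freeg K / R} -> R^o} :=
  HB.pack (coeff x : _ -> R^o) (GRing.isLinear.Build _ _ _ _ _ (coeff_lin x)).
have [v hv] : exists v : K -> bool -> bool -> bool -> R^o, forall x i j l,
    x \in flatten [seq dom (w t.1.1 t.1.2 t.2) | t <- enum {: bool * bool * bool}] ->
    coeff x (w i j l) = koszul a b c (v x) i j l.
  elim: (flatten _) => [|y s [v hv]]; first by exists (fun _ _ _ _ => 0).
  have [i j l|vy hvy] := exR (fun i j l => co y (w i j l)).
    by rewrite -koszul_linear Dw0 linear0.
  exists (fun x => if x == y then vy else v x) => x i j l; rewrite inE.
  by have [-> _|_ /=] := eqVneq x y; [apply: hvy | apply: hv].
set s := flatten _ in hv.
exists (fun i j l => \sum_(x <- undup s) << v x i j l *g x >>) => i j l.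
apply/eqP/freeg_eqP => x; rewrite -[RHS]/(co x _) koszul_linear.
have co_sum i' j' l' : co x (\sum_(y <- undup s) << v y i' j' l' *g y >>) =
    if x \in s then v x i' j' l' else 0.
  rewrite linear_sum /=; under eq_bigr do rewrite coeffU.
  case: ifPn => xs.
    rewrite (bigD1_seq x) ?undup_uniq ?mem_undup //= eqxx mulr1 big1 ?addr0 //.
    by move=> y /negPf ->; rewrite mulr0.
  rewrite big_seq big1 // => y; rewrite mem_undup => ys.
  by case: eqP ys => [->|_]; rewrite ?(negPf xs) ?mulr0.
rewrite /koszul !co_sum; case: ifPn => xs; first exact: hv.
rewrite !scaler0 !addr0 coeff_outdom //; apply: contraNN xs => xs.
by apply/flattenP; exists (dom (w i j l)) => //; apply/mapP; exists (i, j, l); rewrite ?mem_enum.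
Qed.

(** [P] is a retract of the free module on its own elements, and exactness passes to retracts. *)
Lemma koszul_exact_projective (R : comNzRingType) (a b c : bool -> R) (P : lmodType R) :
  koszul_exact a b c R^o -> projective_mod P -> koszul_exact a b c P.
Proof.
move=> exR projP w Dw0.
pose f : {linear {freeg P / R} -> P} := HB.pack (fglift id : {freeg P / R} -> P)
  (GRing.isLinear.Build _ _ _ _ _ (fglift_linear id)).
have [|h hK] := projP {freeg P / R} P f idfun.
  by move=> x; exists << x >>; rewrite /= liftU scale1r.
have [i j l|v hv] := koszul_exact_freeg exR (w := fun i j l => h (w i j l)).
  by rewrite -koszul_linear Dw0 linear0.
exists (fun i j l => f (v i j l)) => i j l.
by rewrite -koszul_linear -hv hK.
Qed.

(* Exactness of the 2-periodic complex passes to modules of finite projective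
   dimension by shifting along the resolution. *)
Lemma koszul_exact_finite_pd (R : comNzRingType) (a b c : bool -> R) (M : lmodType R) :
  a true * a false + b true * b false + c true * c false = 0 ->
  koszul_exact a b c R^o -> finite_pd M -> koszul_exact a b c M.
Proof.
move=> sq0 exR [m [P [d [e [e_surj e_ker d_ker projP Pm0]]]]].
(* [shift f] is exactness over [V] modulo the kernel of [f], that is, over the image of [f]. *)
pose shift (V W : lmodType R) (f : {linear V -> W}) := forall w : bool -> bool -> bool -> V,
  (forall i j l, f (koszul a b c w i j l) = 0) ->
  exists v, forall i j l, f (w i j l - koszul a b c v i j l) = 0.
(* The image of [f] is [V] modulo the image of [g]. The complex is exact over the projective [V], so
   exactness over the image of [g] passes to the image of [f]. *)
have step i (V W : lmodType R) (f : {linear V -> W}) (g : {linear P i -> V}) :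
    projective_mod V -> (forall x, f x = 0 <-> exists y, g y = x) -> shift _ _ g -> shift _ _ f.
  move=> projV ker_f Hg w fw0.
  have [y hy] : exists y, forall i j l, g (y i j l) = koszul a b c w i j l.
    apply: (bool3_choice (P := fun i j l y => g y = koszul a b c w i j l)) => i' j' l'.
    exact/ker_f.
  have [i' j' l'|v hv] := Hg y.
    rewrite koszul_linear /koszul !hy -/(koszul a b c (koszul a b c w) i' j' l').
    by rewrite koszul_sq sq0 scale0r.
  have [i' j' l'|v' hv'] := koszul_exact_projective exR projV (w := fun i j l => w i j l - g (v i j l)).
    rewrite koszulB -koszul_linear -hy -linearB; exact: hv.
  exists v' => i' j' l'; apply/ker_f; exists (v i' j' l').
  by rewrite -hv' opprB addrC subrK.
have shift_d i : shift _ _ (d i).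
  have [n] := ubnP (m - i); elim: n i => // n IH i hn.
  have [lt_mi|le_im] := ltnP m i.+1.
    move=> w _; exists (fun _ _ _ => 0) => i' j' l'.
    by rewrite (Pm0 _ lt_mi (_ - _)) linear0.
  refine (step i.+2 _ _ (d i) (d i.+1) (projP _) (d_ker i) _); apply: IH.
  by rewrite subnS -ltnS; apply: leq_trans hn; rewrite ltnS prednK ?subn_gt0.
have shift_e : shift _ _ e := step 1%N _ _ e (d 0%N) (projP _) e_ker (shift_d _).
move=> w Dw0; have [y hy] : exists y, forall i j l, e (y i j l) = w i j l.
  by apply: (bool3_choice (P := fun i j l y => e y = w i j l)) => i j l; apply: e_surj.
have [i j l|v hv] := shift_e y.
  by rewrite koszul_linear /koszul !hy; apply: Dw0.
exists (fun i j l => e (v i j l)) => i j l.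
by apply/eqP; rewrite -hy -koszul_linear -subr_eq0 -linearB hv.
Qed.

(** * The Koszul complex of the Fermat polynomial *)

Lemma koszul_rmorph (P R : comNzRingType) (phi : {rmorphism P -> R}) (a b c : bool -> P)
    (w : bool -> bool -> bool -> P^o) i j l :
  phi (koszul a b c w i j l) =
  koszul (fun i => phi (a i)) (fun i => phi (b i)) (fun i => phi (c i))
    (fun i j l => phi (w i j l) : R^o) i j l.
Proof. by rewrite /koszul /GRing.scale /= !rmorphD !rmorphM !rmorphXn !rmorphN1. Qed.

Lemma koszulD (R : comNzRingType) (a b c : bool -> R) (V : lmodType R)
    (w w' : bool -> bool -> bool -> V) i j l :
  koszul a b c (fun i j l => w i j l + w' i j l) i j l =
  koszul a b c w i j l + koszul a b c w' i j l.
Proof. by rewrite /koszul !scalerDr [LHS](AC (2*2*2) ((1*3*5)*(2*4*6))). Qed.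

(** For [r <= n], the two factors of [t ^+ n] in the matrix factorization. *)
Definition split_exp (R : comNzRingType) (n r : nat) (t : R) (i : bool) : R :=
  t ^+ (if i then r else n - r)%N.

Definition in_powers (k : fieldType) N (p : {mpoly k[3]}) : Prop :=
  exists a b c, p = a * vx k ^+ N + b * vy k ^+ N + c * vz k ^+ N.

Lemma in_powersD (k : fieldType) N (p q : {mpoly k[3]}) :
  in_powers N p -> in_powers N q -> in_powers N (p + q).
Proof.
move=> [a [b [c ->]]] [a' [b' [c' ->]]].
by exists (a + a'), (b + b'), (c + c'); ring.
Qed.

Lemma in_powersM (k : fieldType) N (p q : {mpoly k[3]}) :
  in_powers N q -> in_powers N (p * q).
Proof.
by move=> [a [b [c ->]]]; exists (p * a), (p * b), (p * c); ring.
Qed.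

(** A cycle is lifted to polynomials [W], whose differential is [g] times [fermat]. Over the
    polynomial ring the squared differential is multiplication by [fermat], a nonzero divisor, so
    [W] minus the differential of [g] is a cycle and hence zero. *)
Lemma koszul_exact_presented (k : fieldType) (n r : nat) (R : comNzRingType)
    (phi : {rmorphism {mpoly k[3]} -> R}) :
  (0 < n)%N -> (r <= n)%N -> presents_Rkn n phi ->
  koszul_exact (fun i => phi (split_exp n r (vx k) i)) (fun i => phi (split_exp n r (vy k) i))
    (fun i => phi (split_exp n r (vz k) i)) R^o.
Proof.
move=> n0 rn [phi_surj phi_ker] w Dw0.
have [W hW] : exists W : bool -> bool -> bool -> {mpoly k[3]}^o, forall i j l, phi (W i j l) = w i j l.
  by apply: (bool3_choice (P := fun i j l W => phi W = w i j l)) => i j l; apply: phi_surj.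
set a := split_exp n r (vx k); set b := split_exp n r (vy k); set c := split_exp n r (vz k).
have [g hg] : exists g : bool -> bool -> bool -> {mpoly k[3]}^o,
    forall i j l, koszul a b c W i j l = g i j l * fermat k n.
  apply: (bool3_choice (P := fun i j l g => koszul a b c W i j l = g * fermat k n)) => i j l.
  by apply/phi_ker; rewrite koszul_rmorph /koszul !hW; apply: Dw0.
have sq (v : bool -> bool -> bool -> {mpoly k[3]}^o) i j l :
    koszul a b c (koszul a b c v) i j l = fermat k n *: v i j l.
  by rewrite koszul_sq; congr (_ *: _); rewrite /a /b /c /split_exp -!exprD subnKC.
pose W' : bool -> bool -> bool -> {mpoly k[3]}^o := fun i j l => W i j l - koszul a b c g i j l.
have D0 i j l : koszul a b c W' i j l = 0.
  by rewrite koszulB sq hg mulrC; apply: subrr.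
have WE i j l : W i j l = koszul a b c g i j l.
  apply/eqP; rewrite -subr_eq0 -[_ - _]/(W' i j l); have := sq W' i j l.
  rewrite {1}/koszul !D0 !scaler0 !addr0 => /esym/eqP.
  by rewrite mulf_eq0 (negPf (fermat_neq0 k n0)).
exists (fun i j l => phi (g i j l)) => i j l.
by rewrite -hW WE koszul_rmorph.
Qed.

(** Exactness over [M] holds for polynomials modulo [N]-th powers and multiples of [fermat]. The
    latter are themselves boundaries, being values of the squared differential. *)
Lemma koszul_exact_mod_powers (k : fieldType) (n N r : nat) (R : comNzRingType)
    (phi : {rmorphism {mpoly k[3]} -> R}) (M : lmodType R) (pi : {linear R^o -> M}) :
  (0 < n)%N -> (r <= n)%N -> presents_Rkn n phi -> presents_Q N phi pi -> finite_pd M ->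
  forall w : bool -> bool -> bool -> {mpoly k[3]}^o,
  (forall i j l, in_powers N (koszul (split_exp n r (vx k)) (split_exp n r (vy k)) (split_exp n r (vz k)) w i j l)) ->
  exists v : bool -> bool -> bool -> {mpoly k[3]}^o, forall i j l,
    in_powers N (w i j l - koszul (split_exp n r (vx k)) (split_exp n r (vy k)) (split_exp n r (vz k)) v i j l).
Proof.
move=> n0 rn presR [pi_surj pi_ker] fpd w Dw.
have [phi_surj phi_ker] := presR.
set a := split_exp n r (vx k) in Dw *; set b := split_exp n r (vy k) in Dw *.
set c := split_exp n r (vz k) in Dw *.
have abc : a true * a false + b true * b false + c true * c false = fermat k n.
  by rewrite /a /b /c /split_exp -!exprD subnKC.
have exM : koszul_exact (fun i => phi (a i)) (fun i => phi (b i)) (fun i => phi (c i)) M.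
  apply: koszul_exact_finite_pd fpd; last exact: koszul_exact_presented.
  by rewrite -!rmorphM -!rmorphD abc; apply/phi_ker; exists 1; rewrite mul1r.
have [i j l|m hm] := exM (fun i j l => pi (phi (w i j l))).
  rewrite -(koszul_linear _ _ _ pi (fun i j l => phi (w i j l))) -koszul_rmorph.
  have [p [q [s ->]]] := Dw i j l.
  by apply/pi_ker; exists (phi p), (phi q), (phi s); rewrite !rmorphD !rmorphM.
have [v hv] : exists v : bool -> bool -> bool -> {mpoly k[3]}^o, forall i j l, pi (phi (v i j l)) = m i j l.
  apply: (bool3_choice (P := fun i j l v => pi (phi v) = m i j l)) => i j l.
  by have [s <-] := pi_surj (m i j l); have [p <-] := phi_surj s; exists p.
have [g hg] : exists g : bool -> bool -> bool -> {mpoly k[3]}^o, forall i j l,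
    in_powers N (w i j l - koszul a b c v i j l - g i j l * fermat k n).
  apply: (bool3_choice (P := fun i j l g => in_powers N (w i j l - koszul a b c v i j l - g * fermat k n))) => i j l.
  have : pi (phi (w i j l - koszul a b c v i j l)) = 0.
    rewrite rmorphB linearB koszul_rmorph koszul_linear /koszul !hv hm.
    exact: subrr.
  move/pi_ker => [p' [q' [s' e]]].
  have [p hp] := phi_surj p'; have [q hq] := phi_surj q'; have [s hs] := phi_surj s'.
  move: e; rewrite -hp -hq -hs -!rmorphM -!rmorphD => /eqP; rewrite -subr_eq0 -rmorphB.
  move/eqP/phi_ker => [g eg]; exists g; exists p, q, s.
  by rewrite -[fermat k n]/(vx k ^+ n + vy k ^+ n + vz k ^+ n) -eg; ring.
exists (fun i j l => v i j l + koszul a b c g i j l) => i j l.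
rewrite koszulD koszul_sq abc opprD addrA.
by have := hg i j l; rewrite [_ * fermat k n]mulrC.
Qed.

(** * Relations from annihilated classes *)

(** If [f] lists coefficients in one variable, [pre f] lists them after multiplication by that
    variable. *)
Definition pre (V : zmodType) (f : nat -> V) (i : nat) : V := if i is i'.+1 then f i' else 0.

(** In [h] the first index belongs to the coefficient, the second to the monomial; the last term is
    the overflow at exponent [M]. *)
Lemma sum_shift (V : zmodType) M (h : nat -> nat -> V) :
  \sum_(i < M) h i i.+1 = \sum_(i < M) pre (h^~ i) i + pre (h^~ M) M.
Proof.
elim: M => [|M IH]; first by rewrite !big_ord0 addr0.
by rewrite !big_ord_recr /= IH.
Qed.

Lemma pre_scale (k : fieldType) (V : lmodType k) (f : nat -> k) (v : V) i :
  pre (fun i => f i *: v) i = pre f i *: v.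
Proof. by case: i => //=; rewrite scale0r. Qed.

Lemma pre_sum (V : zmodType) (I : finType) (F : nat -> I -> V) i :
  pre (fun i => \sum_j F i j) i = \sum_j pre (F^~ j) i.
Proof. by case: i => //=; rewrite big1. Qed.

Lemma pre_neq0 (V : zmodType) (f : nat -> V) i : pre f i != 0 ->
  exists2 i', i = i'.+1 & f i' != 0.
Proof. by case: i => [|i] /=; rewrite ?eqxx // => fi; exists i. Qed.

Lemma size_sum_leq (k : fieldType) (I : finType) (F : I -> {poly k}) m :
  (forall i, (size (F i) <= m)%N) -> (size (\sum_i F i)%R <= m)%N.
Proof.
move=> h; elim/big_rec: _ => [|i p _ hp]; first by rewrite size_poly0.
by rewrite (leq_trans (size_polyD _ _)) // geq_max h.
Qed.

(* A class killed by [X + Y + Z] in degree [m] of [k[X, Y, Z] / (X^a1, Y^a2, Z^a3)]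
   lifts to a relation of degree [m + 1] once [Z] is set to [-(X + Y)]. *)
Lemma syz_of_annihilated (k : fieldType) (a1 a2 a3 m : nat) (g : nat -> nat -> nat -> k) i0 j0 l0 :
  (forall i j l, g i j l != 0 -> [/\ i < a1, j < a2, l < a3 & i + j + l = m]%N) ->
  (forall i j l, (i < a1)%N -> (j < a2)%N -> (l < a3)%N ->
     pre (fun i => g i j l) i + pre (fun j => g i j l) j + pre (fun l => g i j l) l = 0) ->
  g i0 j0 l0 != 0 ->
  exists u v : {poly k}, u != 0 /\ syz a1 a2 a3 m.+1 u v.
Proof.
move=> supp ann g0; pose z : {poly k} := - ('X + 1).
have sz l : size (z ^+ l) = l.+1.
  by rewrite exprNn -signr_odd; case: odd; rewrite ?expr1 ?mulN1r ?expr0 ?mul1r ?size_polyN size_X1_exp.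
have szT (i l : nat) : size ('X^i * z ^+ l) = (i + l).+1.
  by rewrite mulrC size_mulXn ?sz ?addnS // -size_poly_gt0 sz.
pose T (i l : nat) := 'X^i * z ^+ l.
(* [u], [v], [w] collect the overflow at [X ^ a1], [Y ^ a2], [Z ^ a3] when the lift [G] of the class
   is multiplied by [X], [Y = 1] and [Z = z]; the remaining terms cancel by [ann]. *)
pose u := \sum_(j < a2) \sum_(l < a3) pre (fun i => g i j l) a1 *: T a1 l.
pose v := \sum_(i < a1) \sum_(l < a3) pre (fun j => g i j l) a2 *: T i l.
pose w := \sum_(i < a1) \sum_(j < a2) pre (fun l => g i j l) a3 *: T i a3.
have uvw : u + v + w = 0.
  pose G := \sum_(i < a1) \sum_(j < a2) \sum_(l < a3) g i j l *: T i l.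
  have e1 : 'X * G = \sum_(i < a1) \sum_(j < a2) \sum_(l < a3) pre (fun i => g i j l) i *: T i l + u.
    have -> : 'X * G = \sum_(i < a1) \sum_(j < a2) \sum_(l < a3) g i j l *: T i.+1 l.
      rewrite /G; do 3![rewrite mulr_sumr; apply: eq_bigr => ? _].
      by rewrite -scalerAr /T exprS mulrA.
    rewrite (@sum_shift _ a1 (fun i i' => \sum_(j < a2) \sum_(l < a3) g i j l *: T i' l)).
    congr (_ + _); first apply: eq_bigr => i _.
      by rewrite pre_sum; apply: eq_bigr => j _; rewrite pre_sum; apply: eq_bigr => l _; rewrite pre_scale.
    by rewrite pre_sum; apply: eq_bigr => j _; rewrite pre_sum; apply: eq_bigr => l _; rewrite pre_scale.
  have e2 : G = \sum_(i < a1) \sum_(j < a2) \sum_(l < a3) pre (fun j => g i j l) j *: T i l + v.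
    rewrite /v -big_split; apply: eq_bigr => i _ /=.
    rewrite (@sum_shift _ a2 (fun j _ => \sum_(l < a3) g i j l *: T i l)).
    congr (_ + _); first apply: eq_bigr => j _.
      by rewrite pre_sum; apply: eq_bigr => l _; rewrite pre_scale.
    by rewrite pre_sum; apply: eq_bigr => l _; rewrite pre_scale.
  have e3 : z * G = \sum_(i < a1) \sum_(j < a2) \sum_(l < a3) pre (fun l => g i j l) l *: T i l + w.
    rewrite /G mulr_sumr /w -big_split; apply: eq_bigr => i _ /=.
    rewrite mulr_sumr -big_split; apply: eq_bigr => j _ /=.
    have -> : z * (\sum_(l < a3) g i j l *: T i l) = \sum_(l < a3) g i j l *: T i l.+1.
      by rewrite mulr_sumr; apply: eq_bigr => l _; rewrite -scalerAr /T exprS mulrCA.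
    rewrite (@sum_shift _ a3 (fun l l' => g i j l *: T i l')).
    by congr (_ + _); first apply: eq_bigr => l _; rewrite pre_scale.
  have e0 : 'X * G + G + z * G = 0 by rewrite /z; ring.
  move: e0; rewrite e1 e3 {1}e2 [X in X = _ -> _](AC (2*2*2) ((1*3*5)*(2*4*6))) -!big_split /= big1 ?add0r //.
  move=> i _; rewrite -!big_split big1 //= => j _; rewrite -!big_split big1 //= => l _.
  by rewrite -!scalerDl ann ?scale0r.
exists u, v; split; last first.
  split.
  - apply: (big_ind (fun p => 'X^a1 %| p)) => [|*|j _]; rewrite ?dvdp0 ?dvdp_add //.
    apply: (big_ind (fun p => 'X^a1 %| p)) => [|*|l _]; rewrite ?dvdp0 ?dvdp_add //.
    by rewrite /T scalerAr dvdp_mulIl.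
  - have -> : u + v = - w by apply/eqP; rewrite -addr_eq0 uvw.
    rewrite dvdpNr; apply: (big_ind (fun p => ('X + 1) ^+ a3 %| p)) => [|*|i _]; rewrite ?dvdp0 ?dvdp_add //.
    apply: (big_ind (fun p => ('X + 1) ^+ a3 %| p)) => [|*|j _]; rewrite ?dvdp0 ?dvdp_add //.
    by rewrite /T /z exprNn scalerAl mulrA dvdp_mulIr.
  - apply: size_sum_leq => j; apply: size_sum_leq => l.
    have [->|/pre_neq0[a ea ga]] := eqVneq (pre (fun i => g i j l) a1) 0; first by rewrite scale0r size_poly0.
    have [_ _ _ e] := supp _ _ _ ga.
    by rewrite (leq_trans (size_scale_leq _ _)) // szT; nat_lia.
  - apply: size_sum_leq => i; apply: size_sum_leq => l.
    have [->|/pre_neq0[a ea ga]] := eqVneq (pre (fun j => g i j l) a2) 0; first by rewrite scale0r size_poly0.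
    have [_ _ _ e] := supp _ _ _ ga.
    by rewrite (leq_trans (size_scale_leq _ _)) // szT; nat_lia.
have [i0a _ _ _] := supp _ _ _ g0.
clear uvw v w; move: @u; case: a1 supp ann i0a => // a supp ann i0a u.
(* If [u] vanished, so would the coefficients with maximal first index: powers of [z] are
   independent, and in fixed degree [l] determines [j]. *)
apply/eqP => u0.
have q0 : \sum_(j < a2) \sum_(l < a3) g a j l *: 'X^l = 0 :> {poly k}.
  apply/eqP; rewrite -(@comp_poly2_eq0 _ _ z); last by have := sz 1%N; rewrite expr1.
  rewrite raddf_sum /=; under eq_bigr => j _.
    rewrite raddf_sum /=; under eq_bigr => l _ do rewrite comp_polyZ comp_Xn_poly.
    over.
  have X0 : ('X^(a.+1) : {poly k}) != 0 by rewrite expf_neq0 ?polyX_eq0.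
  rewrite -(mulrI_eq0 _ (lregP X0)) mulr_sumr; move/eqP: u0; rewrite /u; congr (_ == 0).
  by apply: eq_bigr => j _; rewrite mulr_sumr; apply: eq_bigr => l _; rewrite /= scalerAr.
have top j l : (j < a2)%N -> (l < a3)%N -> g a j l = 0.
  move=> ltj ltl; apply/eqP; apply: contraT => gn0.
  have coef_l (j' : nat) : (\sum_(l' < a3) g a j' l' *: 'X^l' : {poly k})`_l = g a j' l.
    rewrite coef_sum (bigD1 (Ordinal ltl)) //= coefZ coefXn eqxx mulr1 big1 ?addr0 //.
    by move=> l' /negPf nl; rewrite coefZ coefXn eq_sym -[_ == l]/(l' == Ordinal ltl) nl mulr0.
  have := congr1 (fun p : {poly k} => p`_l) q0; rewrite coef0 coef_sum.
  rewrite (bigD1 (Ordinal ltj)) //= coef_l big1 ?addr0 => [/eqP|j' /negPf nj].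
    by rewrite (negPf gn0).
  rewrite coef_l; apply/eqP; apply: contraT => /supp[_ _ _ e']; have [_ _ _ e] := supp _ _ _ gn0.
  by move: nj; rewrite -val_eqE /=; case: eqP => // nj _; lia.
(* The equation [ann] at first index [i + 1] expresses [g i j l] by values at first index [i + 1],
   so vanishing descends. *)
have all0 s : forall i j l, (i + s = a)%N -> (j < a2)%N -> (l < a3)%N -> g i j l = 0.
  elim: s => [|s IH] i j l; first by rewrite addn0 => ->; apply: top.
  move=> es ltj ltl; have := ann i.+1 j l _ ltj ltl; rewrite /= => <-; last by lia.
  have -> : pre (fun j => g i.+1 j l) j = 0.
    by case: j ltj => //= j ltj; apply: IH; rewrite ?addSnnS // ltnW.
  have -> : pre (fun l => g i.+1 j l) l = 0.
    by case: l ltl => //= l ltl; apply: IH; rewrite ?addSnnS // ltnW.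
  by rewrite !addr0.
have [_ j0a l0a _] := supp _ _ _ g0.
by move: g0; rewrite (all0 (a - i0)%N) ?eqxx // subnKC // -ltnS.
Qed.

(** * A cocycle in the anticommuting algebra *)

Lemma square_kernel (k : fieldType) (T : finType) (F : (T -> k) -> T -> k) (s : T) :
  (forall c c', c =1 c' -> F c =1 F c') ->
  (forall l c c' t, F (fun u => l * c u + c' u) t = l * F c t + F c' t) ->
  (forall c, F c s = 0) -> exists2 c, (exists t, c t != 0) & forall t, F c t = 0.
Proof.
move=> Fext Flin Fs.
pose f (v : 'rV[k]_#|T|) : 'rV[k]_#|T| := \row_j F (fun t => v 0 (enum_rank t)) (enum_val j).
have flin : linear f.
  move=> l u v; apply/rowP => j; rewrite !mxE -Flin; apply: Fext => t.
  by rewrite !mxE.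
pose f' : {linear 'rV[k]_#|T| -> 'rV[k]_#|T|} := HB.pack f (GRing.isLinear.Build _ _ _ _ f flin).
have colz : col (enum_rank s) (lin1_mx f') = 0.
  by apply/colP => i; rewrite !mxE enum_rankK Fs.
(* Coordinate [s] of every value vanishes, so the unit vector at [s] is not attained and the square
   matrix is singular. *)
have rk : (\rank (lin1_mx f') < #|T|)%N.
  rewrite ltn_neqAle rank_leq_row andbT; apply/negP => full.
  have /row_fullP[B BA] : row_full (lin1_mx f') by [].
  have := congr1 (col (enum_rank s)) BA; rewrite colE -mulmxA -colE colz mulmx0.
  by move/colP/(_ (enum_rank s)); rewrite !mxE eqxx => /eqP; rewrite eq_sym oner_eq0.
have : kermx (lin1_mx f') != 0.
  by rewrite kermx_eq0 /row_free neq_ltn rk.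
case/rowV0Pn => v /sub_kermxP vK v0.
exists (fun t => v 0 (enum_rank t)).
  have [j vj] : exists j, v 0 j != 0.
    apply/existsP; apply: contraR v0; rewrite negb_exists => /forallP h.
    by apply/eqP/rowP => j; rewrite mxE; apply/eqP; have := h j; rewrite negbK.
  by exists (enum_val j); rewrite enum_valK.
move=> t; have : f' v = 0 by rewrite -vK mul_rV_lin1.
by move/rowP/(_ (enum_rank t)); rewrite !mxE enum_rankK.
Qed.

(* Left multiplication by [D1 + D2 + D3] on coefficients of the monomials
   [D1^i D2^j D3^l] in anticommuting variables. *)
Definition cliff (k : fieldType) (c : nat -> nat -> nat -> k) (i j l : nat) : k :=
  pre (fun i => c i j l) i + (-1) ^+ i * pre (fun j => c i j l) j
  + (-1) ^+ (i + j)%N * pre (fun l => c i j l) l.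

(** The mixed products cancel by anticommutation, leaving the sum of the three squares. *)
Lemma cliff_sq (k : fieldType) (c : nat -> nat -> nat -> k) i j l :
  cliff (cliff c) i j l = pre (pre (fun i => c i j l)) i + pre (pre (fun j => c i j l)) j
    + pre (pre (fun l => c i j l)) l.
Proof.
have E (b : nat) : (-1 : k) ^+ b.+1 = - (-1) ^+ b by rewrite exprS mulN1r.
rewrite /cliff; case: i => [|i]; case: j => [|j]; case: l => [|l] /=;
  rewrite ?addSn ?addnS ?addn0 ?E ?exprD;
  rewrite -?(signr_odd _ i) -?(signr_odd _ j); try case: (odd i); try case: (odd j);
  rewrite ?expr0 ?expr1; ring.
Qed.

(** Among monomials with exponents at most [2 * th] there is one more in degree [3 * th] than in
    degree [3 * th + 1], so there are more unknowns than equations. *)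
Lemma exists_cocycle (k : fieldType) th :
  exists c : nat -> nat -> nat -> k,
  [/\ exists i j l, [/\ (i <= 2 * th)%N, (j <= 2 * th)%N, (l <= 2 * th)%N,
        (i + j + l = 3 * th)%N & c i j l != 0],
     forall i j l, (i <= 2 * th)%N -> (j <= 2 * th)%N -> (l <= 2 * th)%N ->
       (i + j + l)%N <> (3 * th)%N -> c i j l = 0
   & forall i j l, (i <= 2 * th)%N -> (j <= 2 * th)%N -> (l <= 2 * th)%N ->
       (i + j + l = (3 * th).+1)%N -> cliff c i j l = 0].
Proof.
pose T : finType := ('I_(2 * th).+1 * 'I_(2 * th).+1 * 'I_(2 * th).+1)%type.
pose N (c : T -> k) (i j l : nat) : k := c (inord i, inord j, inord l).
(* The equations in degree [3 th + 1] are indexed injectively by the monomials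
   of degree [3 th] other than [(2 th, th, 0)], so the system is not invertible. *)
pose F (c : T -> k) (t : T) : k :=
  let i := val t.1.1 in let j := val t.1.2 in let l := val t.2 in
  if (i + j + l == 3 * th)%N then
    if (i < 2 * th)%N then cliff (N c) i.+1 j l
    else if l == 0%N then 0 else cliff (N c) 0 (j + th).+1 (l + th)
  else c t.
have cl_ext c c' : c =1 c' -> forall i j l, cliff (N c) i j l = cliff (N c') i j l.
  by move=> e i j l; rewrite /cliff /N; congr (_ + _ * _ + _ * _); [case: i | case: j | case: l] => //= *; rewrite e.
have cl_lin x c c' i j l : cliff (N (fun u => x * c u + c' u)) i j l = x * cliff (N c) i j l + cliff (N c') i j l.
  by rewrite /cliff /N; case: i => [|i]; case: j => [|j]; case: l => [|l] /=; ring.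
have [|||c [t ct] Fc] := @square_kernel k T F (inord (2 * th), inord th, inord 0).
- move=> c c' e t; rewrite /F; case: ifP => // _; case: ifP => _; first exact: cl_ext.
  by case: ifP => // _; apply: cl_ext.
- move=> x c c' t; rewrite /F; case: ifP => // _; case: ifP => _; first exact: cl_lin.
  by case: ifP => [_|_]; [rewrite mulr0 addr0 | apply: cl_lin].
- move=> c; rewrite /F /= !inordK //; try nat_lia.
  by rewrite ifT ?ltnn //; apply/eqP; nat_lia.
have sz (i j l : nat) : (i <= 2 * th)%N -> (j <= 2 * th)%N -> (l <= 2 * th)%N ->
  (i + j + l)%N <> (3 * th)%N -> N c i j l = 0.
  move=> hi hj hl hs; have := Fc (inord i, inord j, inord l).
  by rewrite /F /= !inordK //; case: eqP.
exists (N c); split=> //.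
  have le_ord (x : 'I_(2 * th).+1) : (x <= 2 * th)%N by rewrite -ltnS.
  exists t.1.1, t.1.2, t.2; split=> //.
    by apply/eqP; apply: contraNT ct => /eqP h; have := Fc t; rewrite /F; case: eqP => // _ ->.
  by rewrite /N !inord_val; move: ct; case: t => -[? ?] ?.
(* The equation at [(0, j, l)] is indexed by [(2 * th, j - th - 1, l - th)], the one at
   [(i + 1, j, l)] by [(i, j, l)]. *)
move=> i j l hi hj hl hs; case: i hi hs => [|i] hi hs.
  have := Fc (inord (2 * th), inord (j - th.+1), inord (l - th)).
  rewrite /F /= !inordK //; try nat_lia.
  rewrite ifT ?ltnn; last by apply/eqP; nat_lia.
  rewrite ifF; last by apply/eqP; nat_lia.
  have -> : ((j - th.+1 + th).+1 = j)%N by nat_lia.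
  by rewrite subnK; last nat_lia.
have := Fc (inord i, inord j, inord l); rewrite /F /= !inordK //; try nat_lia.
by rewrite ifT ?ifT //; apply/eqP; nat_lia.
Qed.

(** * The anticommuting algebra inside the Koszul complex *)

Lemma mcoeff_expX_mul (k : fieldType) n (i : 'I_n) s (p : {mpoly k[n]}) m :
  ('X_i ^+ s * p)@_m = if (s <= m i)%N then p@_(m - U_(i) *+ s) else 0.
Proof.
rewrite mpolyXn mulrC; case: ifP => le_s.
  have lem : (U_(i) *+ s <= m)%MM.
    apply/mnm_lepP => j; rewrite mulmnE mnm1E; case: eqP => [<-|_]; last by rewrite mul0n.
    by rewrite mul1n.
  by rewrite -{1}(submK lem) addmC mcoeffMX.
apply/eqP; rewrite mcoeff_eq0 (perm_mem (msuppMX _ _)); apply/negP => /mapP[m' _ em].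
by move: le_s; rewrite em mnmDE mulmnE mnm1E eqxx mul1n leq_addr.
Qed.

Definition mm (a b c : nat) : 'X_{1..3} := (U_(ox) *+ a + U_(oy) *+ b + U_(oz) *+ c)%MM.

Lemma mmE a b c : (mm a b c ox = a) * (mm a b c oy = b) * (mm a b c oz = c).
Proof. by rewrite /mm !mnmDE !mulmnE !mnm1E /= !mul1n !mul0n !addn0 !add0n. Qed.

Lemma mm_sub a b c s :
  (mm a b c - U_(ox) *+ s = mm (a - s) b c)%MM * (mm a b c - U_(oy) *+ s = mm a (b - s) c)%MM
  * (mm a b c - U_(oz) *+ s = mm a b (c - s))%MM.
Proof.
by do 2?split; apply/mnmP => -[[|[|[|//]]] lti]; rewrite mnmBE mulmnE mnm1E -?val_eqE /=;
  rewrite ?(bool_irrelevance lti isT) !mmE ?mul1n ?mul0n ?subn0.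
Qed.

Lemma mpolyX_mm (k : fieldType) a b c : 'X_[mm a b c] = vx k ^+ a * vy k ^+ b * vz k ^+ c.
Proof. by rewrite /mm !mpolyXD -!mpolyXn. Qed.

Lemma in_powers_coeff (k : fieldType) N (p : {mpoly k[3]}) (m : 'X_{1..3}) :
  in_powers N p -> (m ox < N)%N -> (m oy < N)%N -> (m oz < N)%N -> p@_m = 0.
Proof.
move=> [a [b [c ->]]] hx hy hz.
rewrite !mcoeffD ![_ * _ ^+ N]mulrC !mcoeff_expX_mul.
by rewrite (ltn_geF hx) (ltn_geF hy) (ltn_geF hz) !addr0.
Qed.

Lemma in_powersX (k : fieldType) N a b c : (N <= a)%N || (N <= b)%N || (N <= c)%N ->
  in_powers N ('X_[mm a b c] : {mpoly k[3]}).
Proof.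
rewrite mpolyX_mm => /orP[/orP[h|h]|h]; rewrite -(subnK h) exprD.
- by exists (vx k ^+ (a - N) * vy k ^+ b * vz k ^+ c), 0, 0; ring.
- by exists 0, (vx k ^+ a * vy k ^+ (b - N) * vz k ^+ c), 0; ring.
- by exists 0, 0, (vx k ^+ a * vy k ^+ b * vz k ^+ (c - N)); ring.
Qed.

Lemma in_powers_sum (k : fieldType) N (I : finType) (F : I -> {mpoly k[3]}) :
  (forall i, in_powers N (F i)) -> in_powers N (\sum_i F i).
Proof.
move=> h; apply: (big_ind (in_powers N)) => //; last exact: in_powersD.
by exists 0, 0, 0; ring.
Qed.

(** The exponents 0, [r], [n], [n + r], [2 * n] and so on, reached by multiplying alternately by the
    two factors of [split_exp]. Index [2 * th + 1] gives [N], which is why that power of each [D_i]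
    vanishes. *)
Definition mu n r i : nat := (n * i./2 + odd i * r)%N.

Lemma muS n r i : (r <= n)%N -> mu n r i.+1 = (mu n r i + if odd i.+1 then r else n - r)%N.
Proof. by move=> rn; rewrite /mu /= uphalf_half mulnDr; case: (odd i) => /=; lia. Qed.

Lemma mu_inj n r i j : (0 < n)%N -> odd i = odd j -> mu n r i = mu n r j -> i = j.
Proof.
move=> n0 e /eqP; rewrite /mu e eqn_add2r eqn_pmul2l // => /eqP h.
by rewrite -(odd_double_half i) -(odd_double_half j) e h.
Qed.

(* [bas i j l] is the image of the monomial [D1^i D2^j D3^l] in the Koszul complex. *)
Definition bas (k : fieldType) n r (i j l : nat) (e1 e2 e3 : bool) : {mpoly k[3]}^o :=
  if [&& e1 == odd i, e2 == odd j & e3 == odd l] then 'X_[mm (mu n r i) (mu n r j) (mu n r l)] else 0.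

Lemma koszul_bas (k : fieldType) n r i j l e1 e2 e3 : (r <= n)%N ->
  koszul (split_exp n r (vx k)) (split_exp n r (vy k)) (split_exp n r (vz k)) (bas k n r i j l) e1 e2 e3 =
  bas k n r i.+1 j l e1 e2 e3 + (-1) ^+ i * bas k n r i j.+1 l e1 e2 e3
  + (-1) ^+ (i + j) * bas k n r i j l.+1 e1 e2 e3.
Proof.
move=> rn; rewrite /koszul /bas /split_exp /GRing.scale /= !mpolyX_mm !(muS _ rn) !exprD.
rewrite -(signr_odd _ i) -(signr_odd _ j) /=.
by case: e1; case: e2; case: e3; case: (odd i); case: (odd j); case: (odd l);
  rewrite /= ?expr0 ?expr1; ring.
Qed.

(** Reading coefficients at the monomials of [bas] commutes with the differentials, which makes
    their span a direct summand. By [r < n], nothing enters at index 0. *)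
Lemma koszul_coeff (k : fieldType) n r (v : bool -> bool -> bool -> {mpoly k[3]}^o) i j l :
  (r < n)%N ->
  (koszul (split_exp n r (vx k)) (split_exp n r (vy k)) (split_exp n r (vz k)) v (odd i) (odd j) (odd l))
     @_(mm (mu n r i) (mu n r j) (mu n r l)) =
  cliff (fun i j l => (v (odd i) (odd j) (odd l))@_(mm (mu n r i) (mu n r j) (mu n r l))) i j l.
Proof.
move=> rn; have rn' := ltnW rn.
have sgn (b : nat) (p : {mpoly k[3]}) m : ((-1) ^+ b * p)@_m = (-1) ^+ b * p@_m.
  by rewrite -signr_odd -[in RHS]signr_odd; case: odd; rewrite ?expr0 ?mul1r // expr1 !mulN1r mcoeffN.
rewrite /koszul /GRing.scale /= !mcoeffD -!mulrA !sgn /cliff.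
rewrite -[(-1) ^+ odd i]signr_odd oddb signr_odd.
have -> : (-1) ^+ (odd i + odd j)%N = (-1) ^+ (i + j)%N :> k.
  by rewrite !exprD !signr_odd.
rewrite /split_exp !mcoeff_expX_mul !mmE !mm_sub.
have nr0 : (n - r <= 0)%N = false by apply/negbTE; rewrite -ltnNge subn_gt0.
congr (_ + _ * _ + _ * _).
- case: i => [|i]; first by rewrite /mu /= muln0 nr0.
  by rewrite muS // leq_addl addnK /= negbK.
- case: j => [|j]; first by rewrite /mu /= muln0 nr0.
  by rewrite muS // leq_addl addnK /= negbK.
- case: l => [|l]; first by rewrite /mu /= muln0 nr0.
  by rewrite muS // leq_addl addnK /= negbK.
Qed.

Lemma koszul_sum (R : comNzRingType) (a b c : bool -> R) (V : lmodType R) (I : finType)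
    (w : I -> bool -> bool -> bool -> V) i j l :
  koszul a b c (fun i j l => \sum_s w s i j l) i j l = \sum_s koszul a b c (w s) i j l.
Proof. by rewrite /koszul !scaler_sumr -!big_split. Qed.

Lemma koszulZ (R : comNzRingType) (a b c : bool -> R) (V : lmodType R) (x : R)
    (w : bool -> bool -> bool -> V) i j l :
  koszul a b c (fun i j l => x *: w i j l) i j l = x *: koszul a b c w i j l.
Proof. by rewrite /koszul !scalerDr !scalerA ![x * _]mulrC. Qed.

Lemma pre_mull (R : pzRingType) (f : nat -> R) (x : R) i : pre (fun i => x * f i) i = x * pre f i.
Proof. by case: i => //=; rewrite mulr0. Qed.

Lemma pre_mulr (R : pzRingType) (f : nat -> R) (x : R) i : pre (fun i => f i * x) i = pre f i * x.
Proof. by case: i => //=; rewrite mul0r. Qed.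

Lemma pre_polyC (k : fieldType) n (f : nat -> k) i :
  pre (fun i => (f i)%:MP_[n]) i = (pre f i)%:MP_[n].
Proof. by case: i => //=; rewrite mpolyC0. Qed.

Lemma bas_in_powers (k : fieldType) N n r i j l e1 e2 e3 :
  (N <= mu n r i)%N || (N <= mu n r j)%N || (N <= mu n r l)%N -> in_powers N (bas k n r i j l e1 e2 e3).
Proof.
move=> h; rewrite /bas; case: ifP => _; first exact: in_powersX.
by exists 0, 0, 0; ring.
Qed.

Definition bas_sum (k : fieldType) n r M (c : nat -> nat -> nat -> k) (e1 e2 e3 : bool) : {mpoly k[3]}^o :=
  \sum_(i < M) \sum_(j < M) \sum_(l < M) (c i j l)%:MP *: bas k n r i j l e1 e2 e3.

(** The two sides differ by the overflow at index [M], where the exponent is [N]. *)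
Lemma koszul_bas_sum (k : fieldType) N n r M (c : nat -> nat -> nat -> k) e1 e2 e3 :
  (r <= n)%N -> mu n r M = N ->
  in_powers N (koszul (split_exp n r (vx k)) (split_exp n r (vy k)) (split_exp n r (vz k))
      (bas_sum n r M c) e1 e2 e3 - bas_sum n r M (cliff c) e1 e2 e3).
Proof.
move=> rn muM; pose B i j l := bas k n r i j l e1 e2 e3.
have inM i j l : (N <= mu n r i)%N || (N <= mu n r j)%N || (N <= mu n r l)%N -> in_powers N (B i j l).
  exact: bas_in_powers.
pose S1 := \sum_(i < M) \sum_(j < M) \sum_(l < M) (c i j l)%:MP * B i.+1 j l.
pose S2 := \sum_(i < M) \sum_(j < M) \sum_(l < M) (-1) ^+ i * (c i j l)%:MP * B i j.+1 l.
pose S3 := \sum_(i < M) \sum_(j < M) \sum_(l < M) (-1) ^+ (i + j) * (c i j l)%:MP * B i j l.+1.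
pose T1 := \sum_(i < M) \sum_(j < M) \sum_(l < M) (pre (fun i => c i j l) i)%:MP * B i j l.
pose T2 := \sum_(i < M) \sum_(j < M) \sum_(l < M) (-1) ^+ i * (pre (fun j => c i j l) j)%:MP * B i j l.
pose T3 := \sum_(i < M) \sum_(j < M) \sum_(l < M) (-1) ^+ (i + j) * (pre (fun l => c i j l) l)%:MP * B i j l.
have D1 : in_powers N (S1 - T1).
  rewrite /S1 (@sum_shift _ M (fun i i' => \sum_(j < M) \sum_(l < M) (c i j l)%:MP * B i' j l)).
  have -> : \sum_(i < M) pre ((fun i i' => \sum_(j < M) \sum_(l < M) (c i j l)%:MP * B i' j l)^~ i) i = T1.
    apply: eq_bigr => i _; rewrite pre_sum; apply: eq_bigr => j _; rewrite pre_sum; apply: eq_bigr => l _.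
    by rewrite pre_mulr pre_polyC.
  rewrite addrAC subrr add0r pre_sum; apply: in_powers_sum => j; rewrite pre_sum.
  by apply: in_powers_sum => l; rewrite pre_mulr; apply/in_powersM/inM; rewrite muM leqnn.
have D2 : in_powers N (S2 - T2).
  rewrite /S2 /T2 -sumrB; apply: in_powers_sum => i.
  rewrite (@sum_shift _ M (fun j j' => \sum_(l < M) (-1) ^+ i * (c i j l)%:MP * B i j' l)).
  have -> : \sum_(j < M) pre ((fun j j' => \sum_(l < M) (-1) ^+ i * (c i j l)%:MP * B i j' l)^~ j) j =
      \sum_(j < M) \sum_(l < M) (-1) ^+ i * (pre (fun j => c i j l) j)%:MP * B i j l.
    by apply: eq_bigr => j _; rewrite pre_sum; apply: eq_bigr => l _; rewrite pre_mulr pre_mull pre_polyC.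
  rewrite addrAC subrr add0r pre_sum; apply: in_powers_sum => l.
  by rewrite pre_mulr; apply/in_powersM/inM; rewrite muM leqnn orbT.
have D3 : in_powers N (S3 - T3).
  rewrite /S3 /T3 -sumrB; apply: in_powers_sum => i; rewrite -sumrB; apply: in_powers_sum => j.
  rewrite (@sum_shift _ M (fun l l' => (-1) ^+ (i + j) * (c i j l)%:MP * B i j l')).
  have -> : \sum_(l < M) pre ((fun l l' => (-1) ^+ (i + j) * (c i j l)%:MP * B i j l')^~ l) l =
      \sum_(l < M) (-1) ^+ (i + j) * (pre (fun l => c i j l) l)%:MP * B i j l.
    by apply: eq_bigr => l _; rewrite pre_mulr pre_mull pre_polyC.
  by rewrite addrAC subrr add0r pre_mulr; apply/in_powersM/inM; rewrite muM leqnn !orbT.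
suff -> : koszul (split_exp n r (vx k)) (split_exp n r (vy k)) (split_exp n r (vz k))
      (bas_sum n r M c) e1 e2 e3 - bas_sum n r M (cliff c) e1 e2 e3 = (S1 - T1) + (S2 - T2) + (S3 - T3).
  by apply: in_powersD D3; apply: in_powersD.
have -> : koszul (split_exp n r (vx k)) (split_exp n r (vy k)) (split_exp n r (vz k))
      (bas_sum n r M c) e1 e2 e3 = S1 + S2 + S3.
  rewrite /S1 /S2 /S3 /bas_sum; do 3![rewrite koszul_sum -!big_split; apply: eq_bigr => ? _ /=].
  by rewrite koszulZ koszul_bas // /GRing.scale /= /B; ring.
have -> : bas_sum n r M (cliff c) e1 e2 e3 = T1 + T2 + T3.
  rewrite /T1 /T2 /T3 /bas_sum; do 3![rewrite -!big_split; apply: eq_bigr => ? _ /=].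
  rewrite /cliff !mpolyCD !mpolyCM !rmorphXn !rmorphN1 /GRing.scale /= /B; ring.
ring.
Qed.

Lemma bas_coeff (k : fieldType) n r i j l i' j' l' : (0 < n)%N ->
  (bas k n r i' j' l' (odd i) (odd j) (odd l))@_(mm (mu n r i) (mu n r j) (mu n r l)) =
  [&& i' == i, j' == j & l' == l]%:R.
Proof.
move=> n0; rewrite /bas; case: ifPn => [/and3P[/eqP ei /eqP ej /eqP el]|odds]; last first.
  rewrite mcoeff0; move: odds; case: (i' =P i) => [->|_] //; case: (j' =P j) => [->|_] //.
  by case: (l' =P l) => [->|_] //; rewrite !eqxx.
rewrite mcoeffX; congr (_%:R); congr nat_of_bool; apply/eqP/and3P => [e|[/eqP-> /eqP-> /eqP->]] //.
have [[e1 e2] e3] := mmE (mu n r i') (mu n r j') (mu n r l').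
have [[f1 f2] f3] := mmE (mu n r i) (mu n r j) (mu n r l).
split; apply/eqP; apply: (mu_inj n0 (r := r)); rewrite -?ei -?ej -?el //.
- by rewrite -e1 -f1 e.
- by rewrite -e2 -f2 e.
- by rewrite -e3 -f3 e.
Qed.

Lemma bas_sum_coeff (k : fieldType) n r M (c : nat -> nat -> nat -> k) i j l : (0 < n)%N ->
  (i < M)%N -> (j < M)%N -> (l < M)%N ->
  (bas_sum n r M c (odd i) (odd j) (odd l))@_(mm (mu n r i) (mu n r j) (mu n r l)) = c i j l.
Proof.
move=> n0 lti ltj ltl; rewrite /bas_sum.
have termE (i' j' l' : 'I_M) :
    ((c i' j' l')%:MP *: bas k n r i' j' l' (odd i) (odd j) (odd l))@_(mm (mu n r i) (mu n r j) (mu n r l))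
    = c i' j' l' * [&& i' == Ordinal lti, j' == Ordinal ltj & l' == Ordinal ltl]%:R.
  by rewrite mcoeffCM bas_coeff // -!val_eqE.
transitivity (\sum_(i' < M) \sum_(j' < M) \sum_(l' < M)
    c i' j' l' * [&& i' == Ordinal lti, j' == Ordinal ltj & l' == Ordinal ltl]%:R).
  do 3![rewrite raddf_sum; apply: eq_bigr => ? _ /=].
  exact: termE.
rewrite (bigD1 (Ordinal lti)) //= [X in _ + X]big1 => [|i' /negPf ni]; last first.
  by do 2![apply: big1 => ? _]; rewrite ni mulr0.
rewrite addr0 (bigD1 (Ordinal ltj)) //= [X in _ + X]big1 => [|j' /negPf nj]; last first.
  by apply: big1 => ? _; rewrite nj andbF mulr0.
rewrite addr0 (bigD1 (Ordinal ltl)) //= [X in _ + X]big1 => [|l' /negPf nl]; last first.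
  by rewrite nl !andbF mulr0.
by rewrite addr0 !eqxx mulr1.
Qed.

Lemma syz_of_finite_pd (k : fieldType) (n N th r : nat) (R : comNzRingType)
    (phi : {rmorphism {mpoly k[3]} -> R}) (M : lmodType R) (pi : {linear R^o -> M}) :
  (0 < n)%N -> presents_Rkn n phi -> presents_Q N phi pi ->
  N = (n * th + r)%N -> (0 < r)%N -> (r < n)%N -> finite_pd M ->
  exists a b c d (u v : {poly k}), [/\ (th <= a <= th.+1)%N, (th <= b <= th.+1)%N,
    (th <= c <= th.+1)%N, (2 * d + 2 <= a + b + c)%N & u != 0 /\ syz a b c d u v].
Proof.
move=> n0 presR presQ hN r0 rn fpd.
have [c [[i0 [j0 [l0 [hi0 hj0 hl0 hs0 cn0]]]] csupp ccyc]] := exists_cocycle k th.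
have muM : mu n r (2 * th).+1 = N.
  by rewrite /mu /= mul2n uphalf_double odd_double mul1n hN.
have mu_lt i : (i <= 2 * th)%N -> (mu n r i < N)%N.
  move=> hi; rewrite /mu hN; have := odd_double_half i; case: (odd i) => /= e.
    have : (n * i./2 + n <= n * th)%N by rewrite -mulnSr leq_mul2l; apply/orP; right; nat_lia.
    by nat_lia.
  have : (n * i./2 <= n * th)%N by rewrite leq_mul2l; apply/orP; right; nat_lia.
  by nat_lia.
have cl0 i j l : (i <= 2 * th)%N -> (j <= 2 * th)%N -> (l <= 2 * th)%N -> cliff c i j l = 0.
  move=> hi hj hl; have [e|/eqP ne'] := eqVneq (i + j + l)%N (3 * th).+1; first exact: ccyc.
  have ne : (i + j + l)%N <> (3 * th).+1 by exact: ne'.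
  clear ne'.
  rewrite /cliff; have -> : pre (fun i => c i j l) i = 0.
    by case: i hi ne => //= i hi ne; apply: csupp; nat_lia.
  have -> : pre (fun j => c i j l) j = 0.
    by case: j hj ne => //= j hj ne; apply: csupp; nat_lia.
  have -> : pre (fun l => c i j l) l = 0.
    by case: l hl ne => //= l hl ne; apply: csupp; nat_lia.
  by rewrite !mulr0 !addr0.
have [e1 e2 e3|v hv] := koszul_exact_mod_powers n0 (ltnW rn) presR presQ fpd (w := bas_sum n r (2 * th).+1 c).
  have := koszul_bas_sum c e1 e2 e3 (ltnW rn) muM.
  suff -> : bas_sum n r (2 * th).+1 (cliff c) e1 e2 e3 = 0 by rewrite subr0.
  rewrite /bas_sum; do 3![apply: big1 => ? _].
  by rewrite cl0 ?mpolyC0 ?scale0r // -ltnS.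
pose t i j l : k := (v (odd i) (odd j) (odd l))@_(mm (mu n r i) (mu n r j) (mu n r l)).
have ct i j l : (i <= 2 * th)%N -> (j <= 2 * th)%N -> (l <= 2 * th)%N -> c i j l = cliff t i j l.
  move=> hi hj hl; have [[m1 m2] m3] := mmE (mu n r i) (mu n r j) (mu n r l).
  have := in_powers_coeff (hv (odd i) (odd j) (odd l)) (m := mm (mu n r i) (mu n r j) (mu n r l)).
  rewrite m1 m2 m3 !mu_lt // => /(_ isT isT isT) /eqP.
  by rewrite mcoeffB subr_eq0 bas_sum_coeff // koszul_coeff // => /eqP.
(* [t] has differential [c] and [c] is a cycle, so the squared differential, which is [X + Y + Z],
   kills [t]. *)
have tt0 i j l : (i <= 2 * th)%N -> (j <= 2 * th)%N -> (l <= 2 * th)%N ->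
    pre (pre (fun i => t i j l)) i + pre (pre (fun j => t i j l)) j + pre (pre (fun l => t i j l)) l = 0.
  move=> hi hj hl; rewrite -cliff_sq -(cl0 _ _ _ hi hj hl) /cliff -/(cliff t).
  congr (_ + _ * _ + _ * _).
  - by case: i hi => //= i hi; rewrite ct // ltnW.
  - by case: j hj => //= j hj; rewrite ct // ltnW.
  - by case: l hl => //= l hl; rewrite ct // ltnW.
have [i1 [j1 [l1 [hi1 hj1 hl1 hs1 tn0]]]] : exists i j l, [/\ (i <= 2 * th)%N, (j <= 2 * th)%N,
    (l <= 2 * th)%N, ((i + j + l).+1 = 3 * th)%N & t i j l != 0].
  move: cn0; rewrite ct //.
  have [p1|] := eqVneq (pre (fun i => t i j0 l0) i0) 0; last first.
    by case/pre_neq0 => i ei ti _; exists i, j0, l0; split=> //; nat_lia.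
  have [p2|] := eqVneq (pre (fun j => t i0 j l0) j0) 0; last first.
    by case/pre_neq0 => j ej tj _; exists i0, j, l0; split=> //; nat_lia.
  have [p3|] := eqVneq (pre (fun l => t i0 j0 l) l0) 0; last first.
    by case/pre_neq0 => l el tl _; exists i0, j0, l; split=> //; nat_lia.
  by rewrite /cliff p1 p2 p3 !mulr0 !addr0 eqxx.
(* [X], [Y], [Z] raise one index by 2, so [t] may be restricted to the parity class of
   [(i1, j1, l1)] and to one degree. Halving the indices leaves [A e] values for parity [e]. *)
pose m := (i1./2 + j1./2 + l1./2)%N; have hm : m = (i1./2 + j1./2 + l1./2)%N by [].
pose f (e : bool) a := (2 * a + e)%N.
have fE i : f (odd i) i./2 = i by rewrite /f mul2n addnC odd_double_half.
pose A (e : bool) := (th.+1 - e)%N.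
have fA e a : (a < A e)%N = (f e a <= 2 * th)%N.
  by rewrite /A /f; apply/idP/idP; case: e => /=; lia.
pose g a b d : k := if [&& a < A (odd i1), b < A (odd j1), d < A (odd l1) & a + b + d == m]%N
  then t (f (odd i1) a) (f (odd j1) b) (f (odd l1) d) else 0.
have pre2 (F : nat -> k) (e : bool) a : pre (pre F) (f e a) = pre (fun a => F (f e a)) a.
  case: a => [|a]; first by rewrite /f; case: e.
  by rewrite /f mulnS !addSn /= add0n.
have o1 : (odd i1 <= 1)%N by case: odd.
have o2 : (odd j1 <= 1)%N by case: odd.
have o3 : (odd l1 <= 1)%N by case: odd.
have h1 : (2 * i1./2 + odd i1 = i1)%N by exact: fE.
have h2 : (2 * j1./2 + odd j1 = j1)%N by exact: fE.
have h3 : (2 * l1./2 + odd l1 = l1)%N by exact: fE.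
have [|||u [w [u0 S]]] := @syz_of_annihilated k (A (odd i1)) (A (odd j1)) (A (odd l1)) m g i1./2 j1./2 l1./2.
- by move=> a b d; rewrite /g; case: ifP => [/and4P[? ? ? /eqP ?]|]; rewrite ?eqxx.
- move=> a b d ha hb hd; have [e|ne] := eqVneq (a + b + d)%N m.+1; last first.
    have -> : pre (fun a => g a b d) a = 0.
      by case: a ha ne => //= a _ ne; rewrite /g; case: (a + b + d =P m)%N ne => [<-|_]; rewrite ?addnS ?addSn ?eqxx // !andbF.
    have -> : pre (fun b => g a b d) b = 0.
      by case: b hb ne => //= b _ ne; rewrite /g; case: (a + b + d =P m)%N ne => [<-|_]; rewrite ?addnS ?addSn ?eqxx // !andbF.
    have -> : pre (fun d => g a b d) d = 0.
      by case: d hd ne => //= d _ ne; rewrite /g; case: (a + b + d =P m)%N ne => [<-|_]; rewrite ?addnS ?eqxx // !andbF.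
    by rewrite !addr0.
  rewrite -[RHS](tt0 (f (odd i1) a) (f (odd j1) b) (f (odd l1) d)) -?fA // !pre2.
  congr (_ + _ + _).
  + case: a ha e => //= a ha e; rewrite /g hb hd (ltnW ha) /=.
    by case: eqP => // ne; case: ne; apply/succn_inj; rewrite -e.
  + case: b hb e => //= b hb e; rewrite /g ha hd (ltnW hb) /=.
    by case: eqP => // ne; case: ne; apply/succn_inj; rewrite -e addnS addSn.
  + case: d hd e => //= d hd e; rewrite /g ha hb (ltnW hd) /=.
    by case: eqP => // ne; case: ne; apply/succn_inj; rewrite -e addnS.
- by rewrite /g !fA !fE hi1 hj1 hl1 -hm eqxx.
(* As [i1 + j1 + l1 = 3 * th - 1], twice the degree plus 2 is exactly the sum of the exponents. *)
exists (A (odd i1)), (A (odd j1)), (A (odd l1)), m.+1, u, w.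
by split=> //; rewrite /A; nat_lia.
Qed.

(** * The theorem *)

Lemma near_third_bounds b : (b <= 3 * near_third b + 1)%N /\ (3 * near_third b <= b + 1)%N.
Proof.
rewrite /near_third; have := divn_eq b 3; have := ltn_pmod b (isT : 0 < 3)%N.
case: (b %% 3)%N => [|[|[|//]]] _ /= e.
- by lia.
- have -> : ((b - 1) %/ 3 = b %/ 3)%N by rewrite {1}e addnK mulnK.
  by lia.
- have -> : ((b + 1) %/ 3 = (b %/ 3).+1)%N by rewrite {1}e -addnA -mulSnr mulnK.
  by lia.
Qed.

Lemma dist_quotient_lt (x : int) (N n t : nat) : (0 < n)%N ->
  (`| x%:~R - (N%:R / n%:R) | < t%:R :> rat) = ((x - t%:Z) * n%:Z < N%:Z) && (N%:Z < (x + t%:Z) * n%:Z).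
Proof.
move=> n0; have nR : (0 : rat) < n%:R by rewrite ltr0n.
rewrite distrC ltr_distl ltr_pdivlMr // ltr_pdivrMr //.
by rewrite !pmulrn -rmorphB -rmorphD -!rmorphM !ltr_int.
Qed.

(** For [J = 1] and [q = 2 ^ e] the conditions read [2 * q - 1 <= 3 * th <= 4 * q - 2]. These ranges
    are adjacent for consecutive [e], so the least [e] meeting the upper bound works. *)
Lemma char2_exponent th : (0 < th)%N -> exists2 e, (0 < e)%N &
  (3 * (1 * 2 ^ e) <= 2 ^ e + 1 + 3 * th)%N /\ (3 * th + 2 <= 3 * (1 * 2 ^ e) + 2 ^ e)%N.
Proof.
move=> th0; have ex : exists e, (3 * th + 2 <= 4 * 2 ^ e)%N.
  by exists th; have := ltn_expl th (isT : 1 < 2)%N; lia.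
case: (ex_minnP ex) => e he mine; case: e he mine => [|[|e]] he mine.
- by exists 1%N => //; rewrite expn1; lia.
- by exists 1%N => //; rewrite expn1; lia.
exists e.+2 => //; have : ~~ (3 * th + 2 <= 4 * 2 ^ e.+1)%N.
  by apply/negP => /mine; rewrite ltnn.
by rewrite (expnS 2 e.+1) in he *; lia.
Qed.

Unset Implicit Arguments. Set Strict Implicit. Set Printing Implicit Defensive.

Theorem theorem6p3 (k : fieldType) (n N : nat) (R : comNzRingType)
    (phi : {rmorphism {mpoly k[3]} -> R}) (M : lmodType R)
    (pi : {linear R^o -> M}) :
  (0 < n)%N -> (0 < N)%N ->
  presents_Rkn n phi -> presents_Q N phi pi ->
  (finite_pd M <->
     [\/ (n %| N)%N,
         (2 \in [pchar k]) /\ (n <= N)%N |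
         exists p : nat, [/\ prime p, odd p, p \in [pchar k] &
           exists (J : int) (e : nat), [/\ odd `|J|%N, (1 <= e)%N &
             `| (J * (p ^ e)%:Z)%:~R - (N%:R / n%:R) | < (near_third (p ^ e))%:R :> rat]]])
  /\ ([pchar k] =i pred0 -> (finite_pd M <-> (n %| N)%N)).
Proof.
move=> n0 N0 presR presQ.
suff main : finite_pd M <->
     [\/ (n %| N)%N,
         (2 \in [pchar k]) /\ (n <= N)%N |
         exists p : nat, [/\ prime p, odd p, p \in [pchar k] &
           exists (J : int) (e : nat), [/\ odd `|J|%N, (1 <= e)%N &
             `| (J * (p ^ e)%:Z)%:~R - (N%:R / n%:R) | < (near_third (p ^ e))%:R :> rat]]].
  split=> // char0; rewrite main; split=> [[//|[]|[p [_ _]]]|]; rewrite ?char0 //.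
  by move=> h; apply: Or31.
pose th := (N %/ n)%N; pose r := (N %% n)%N.
have hN : N = (n * th + r)%N by rewrite mulnC; apply: divn_eq.
have rn : (r < n)%N by rewrite ltn_mod.
split=> [fpd|].
  have [r0|r0] := posnP r; first by apply: Or31; rewrite /dvdn -/r r0.
  have [a [b [c [d [u [v [ha hb hc hd [u0 S]]]]]]]] := syz_of_finite_pd n0 presR presQ hN r0 rn fpd.
  have uv : (u != 0) || (v != 0) by rewrite u0.
  have [p [e [J [d' [w1 [w2 [pk e0 oJ [g1 g2] _]]]]]]] := syz_primitive S uv ha hb hc hd.
  have pp := pcharf_prime pk; have J0 : (0 < J)%N by case: (J) oJ.
  (* For [p = 2] the bound [g1] with [J >= 1] and [p ^ e >= 2] forces [th >= 1], that is,
     [n <= N]. *)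
  have [podd|peven] := boolP (odd p); last first.
    have p2 : p = 2 by case/even_prime: pp peven => [->|->].
    apply: Or32; rewrite -p2; split=> //.
    have : (2 <= p ^ e)%N by rewrite p2 -{1}(expn1 2) leq_pexp2l.
    have : (p ^ e <= J * p ^ e)%N by rewrite leq_pmull.
    move=> h1 h2; have th0 : (0 < th)%N by lia.
    by rewrite hN (leq_trans _ (leq_addr _ _)) // leq_pmulr.
  apply: Or33; exists p; split=> //; exists J%:Z, e; split=> //.
  (* With [q = p ^ e] and [t = near_third q], which is within 1/3 of [q / 3], integrality gives
     [J * q <= th + t] and [th + 1 <= J * q + t]; strictness around [N / n] comes from
     [0 < r < n]. *)
  have [t1 t2] := near_third_bounds (p ^ e).
  rewrite dist_quotient_lt //; apply/andP; split.
    have h : (J * p ^ e <= th + near_third (p ^ e))%N by lia.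
    have : (J * p ^ e * n <= (th + near_third (p ^ e)) * n)%N by rewrite leq_mul2r h orbT.
    by rewrite mulrBl -!PoszM ltrBlDr -PoszD ltz_nat; lia.
  have h : (th.+1 <= J * p ^ e + near_third (p ^ e))%N by lia.
  have : (th.+1 * n <= (J * p ^ e + near_third (p ^ e)) * n)%N by rewrite leq_mul2r h orbT.
  by rewrite -!PoszM ltz_nat; lia.
have by_arith p e J : p \in [pchar k] -> odd J -> (3 * (J * p ^ e) <= p ^ e + 1 + 3 * th)%N ->
    (3 * th + 2 <= 3 * (J * p ^ e) + p ^ e)%N -> finite_pd M.
  move=> pk oJ h1 h2; apply: (finite_pd_of_basis_pair n0 presR presQ hN) (basis_pair_of_prime_power pk oJ h1 h2).
  by rewrite mulnS addnC [leqLHS]hN leq_add2l ltnW.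
case=> [/eqP r0|[c2 nN]|[p [pp op pk [J [e [oJ e0]]]]]].
- apply: (finite_pd_of_basis_pair n0 presR presQ hN) (basis_pair_refl k th).
  by rewrite {1}hN /r r0 addn0.
- have [|e e0 [h1 h2]] := @char2_exponent th; first by rewrite divn_gt0.
  exact: (by_arith 2 e 1%N).
rewrite dist_quotient_lt // => /andP[].
have [t1 t2] := near_third_bounds (p ^ e).
have q0 : (0 < p ^ e)%N by rewrite expn_gt0 prime_gt0.
(* For negative [J], the number [J * p ^ e + near_third (p ^ e)] is at most 0 and cannot exceed
   [N / n]. *)
case: J oJ => J oJ; last first.
  have le0 : Negz J * (p ^ e)%:Z + (near_third (p ^ e))%:Z <= 0.
    by rewrite NegzE mulNr addrC subr_le0 -PoszM lez_nat mulSn; lia.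
  have nZ : (0 <= n%:Z) by [].
  move=> _ h; have := lt_le_trans h (mulr_le0_ge0 le0 nZ).
  by rewrite ltz_nat ltn0.
move=> h1 h2.
have {}h1 : (J * p ^ e * n < N + near_third (p ^ e) * n)%N.
  by move: h1; rewrite mulrBl -!PoszM ltrBlDr -PoszD ltz_nat.
have {}h2 : (N < (J * p ^ e + near_third (p ^ e)) * n)%N.
  by move: h2; rewrite -!PoszM ltz_nat.
(* Since [th <= N / n < th + 1], the strict bounds on [N / n] become integer bounds on [th]. *)
apply: (by_arith p e J) => //.
  have : (J * p ^ e < th.+1 + near_third (p ^ e))%N.
    rewrite -(ltn_pmul2r n0); lia.
  lia.
have : (th < J * p ^ e + near_third (p ^ e))%N.
  rewrite -(ltn_pmul2r n0); lia.
lia.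
Qed.
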